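(* Let $\mathcal{A}_\infty=\mathbb{Z}[x]$, graded so that $x^i$ has degree $i$, and let $P_n$ be the $n$-gon, $n\ge 2$. Then the graph cohomology groups $H^{i,j}_{\mathcal{A}_\infty}(P_n)$ are free abelian groups, with Poincaré polynomial (series) $$\sum_{i,j}\operatorname{rank}\bigl(H^{i,j}_{\mathcal{A}_\infty}(P_n)\bigr)\,t^iq^j=(q+q^2+q^3+\cdots)^n+t^{n-2}(q+q^2+q^3+\cdots)=\Bigl(\frac{q}{1-q}\Bigr)^n+t^{n-2}\frac{q}{1-q}.$$
   Context: **Graph cohomology of a polygon over a commutative ring $\mathcal{A}$.** Tensor products are over $\mathbb{Z}$. $P_n$ is the cycle with $n$ vertices and $n$ edges (two vertices joined by two parallel edges if $n=2$); $E$ is its edge set. For $s\subset E$ let $[P_n:s]$ be the subgraph with all vertices and edge set $s$, and $k(s)$ its number of connected components. Put $\Phi(s)=\mathcal{A}^{\otimes k(s)}$, one tensor factor attached to each component. For $e\in E\setminus s$ define $\Phi(s\subset s\cup e):\Phi(s)\to\Phi(s\cup e)$ as follows: if $e$ joins two different components of $[P_n:s]$, the map multiplies the corresponding two factors (the product is attached to the merged component) and leaves the others unchanged; if both endpoints of $e$ lie in the same component of $[P_n:s]$, the map is the identity. Set $C^i=\bigoplus_{|s|=i}\Phi(s)$ with differential which on $\Phi(s)$ is $d=\sum_{e\notin s}(-1)^{t(s,e)}\Phi(s\subset s\cup e)$, where $E$ is given a fixed linear ordering and $t(s,e)$ is the number of elements of $s$ smaller than $e$. The $i$-th cohomology is $H^i_{\mathcal{A}}(P_n)$.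 When $\mathcal{A}$ is graded, the complex is graded by total degree, which $d$ preserves, and $H^{i,j}_{\mathcal{A}}(P_n)$ is the part of internal degree $j$. *)

(* Defs.v *)
From HB Require Import structures.
From mathcomp Require Import all_boot all_order all_algebra.
From mathcomp Require Import generic_quotient ring_quotient.
From mathcomp Require Import boolp.
From mathcomp.multinomials Require Import freeg.

Set Implicit Arguments.
Unset Strict Implicit.
Unset Printing Implicit Defensive.

Import GRing.Theory.
Local Open Scope ring_scope.
Local Open Scope quotient_scope.

Inductive gen (V : zmodType) (S : V -> Prop) : V -> Prop :=
| gen0 : gen S 0
| gen_in x : S x -> gen S x
| genB x y : gen S x -> gen S y -> gen S (x - y).

Section DirectSum.
Variables (I : finType) (M : I -> zmodType).
Implicit Types x y z : {dffun forall i, M i}.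

Definition dsum_zero : {dffun forall i, M i} := [ffun i => 0 : M i].
Definition dsum_opp x : {dffun forall i, M i} := [ffun i => - x i : M i].
Definition dsum_add x y : {dffun forall i, M i} := [ffun i => x i + y i : M i].

Lemma dsum_addA : associative dsum_add.
Proof. by move=> x y z; apply/ffunP=> i; rewrite !ffunE addrA. Qed.
Lemma dsum_addC : commutative dsum_add.
Proof. by move=> x y; apply/ffunP=> i; rewrite !ffunE addrC. Qed.
Lemma dsum_add0 : left_id dsum_zero dsum_add.
Proof. by move=> x; apply/ffunP=> i; rewrite !ffunE add0r. Qed.
Lemma dsum_addN : left_inverse dsum_zero dsum_opp dsum_add.
Proof. by move=> x; apply/ffunP=> i; rewrite !ffunE addNr. Qed.

HB.instance Definition _ := GRing.isZmodule.Build {dffun forall i, M i}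
  dsum_addA dsum_addC dsum_add0 dsum_addN.

Lemma dsum0E i : (0 : {dffun forall i, M i}) i = 0.
Proof. by rewrite ffunE. Qed.
Lemma dsumNE x i : (- x) i = - x i.
Proof. by rewrite ffunE. Qed.
Lemma dsumDE x y i : (x + y) i = x i + y i.
Proof. by rewrite ffunE. Qed.
Lemma dsumBE x y i : (x - y) i = x i - y i.
Proof. by rewrite dsumDE dsumNE. Qed.
End DirectSum.

Definition is_basis (G : zmodType) (r : nat) (b : 'I_r -> G) : Prop :=
  forall x : G, exists! c : {ffun 'I_r -> int}, x = \sum_i b i *~ c i.

Definition free_of_rank (G : zmodType) (r : nat) : Prop :=
  exists b : 'I_r -> G, is_basis b.

Definition free_finite_rank (G : zmodType) : Prop := exists r, free_of_rank G r.

(* 0 is a default value, used only when G is not free of finite rank. *)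
Definition free_rank (G : zmodType) : nat :=
  if pselect (free_finite_rank G) is left h then projT1 (cid h) else 0%N.

Lemma is_basis_leq (G : zmodType) (r s : nat) (b : 'I_r -> G) (c : 'I_s -> G) :
  is_basis b -> is_basis c -> (r <= s)%N.
Proof.
move=> hb hc.
have /choice[M hM] i : exists m : {ffun 'I_s -> int}, b i = \sum_j c j *~ m j.
  by have [m [? _]] := hc (b i); exists m.
have /choice[N hN] j : exists m : {ffun 'I_r -> int}, c j = \sum_i b i *~ m i.
  by have [m [? _]] := hb (c j); exists m.
apply: (@mulmx1_min int r s (\matrix_(i, j) M i j) (\matrix_(j, i) N j i)).
apply/matrixP=> i k; rewrite !mxE.
have [m [_ um]] := hb (b i).
have e1 : m = [ffun k => (i == k)%:R].
  apply: um; rewrite (bigD1 i) //= ffunE eqxx mulr1z big1 ?addr0 // => j ji.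
  by rewrite ffunE eq_sym (negbTE ji).
have e2 : m = [ffun k => \sum_j M i j * N j k].
  apply: um; rewrite {1}hM.
  under eq_bigr do rewrite hN mulrz_suml.
  rewrite exchange_big; apply: eq_bigr => l _; rewrite ffunE mulrz_sumr.
  by apply: eq_bigr => j _; rewrite mulrzA_C.
have /ffunP/(_ k) := etrans (esym e2) e1; rewrite !ffunE => <-.
by apply: eq_bigr => j _; rewrite !mxE.
Qed.

Lemma free_rankE (G : zmodType) (r : nat) : free_of_rank G r -> free_rank G = r.
Proof.
move=> hr; rewrite /free_rank; case: pselect => [h|]; last by case; exists r.
case: (cid h) => s [c hc] /=; case: hr => b hb.
by apply/eqP; rewrite eqn_leq (is_basis_leq hb hc) (is_basis_leq hc hb).
Qed.

Section Tensor.
Variables (A : comNzRingType) (I : finType).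
Implicit Types (f : {ffun I -> A}) (i : I) (a : A).

Definition upd f i a : {ffun I -> A} := [ffun k => if k == i then a else f k].

Definition multilin (z : {freeg {ffun I -> A} / int}) : Prop :=
  exists f i a b,
    z = << upd f i (a + b) >> - << upd f i a >> - << upd f i b >>.

Definition tens_rel : {pred {freeg {ffun I -> A} / int}} :=
  fun z => `[< gen multilin z >].

Lemma tens_rel_closed : zmod_closed tens_rel.
Proof.
split=> [|x y]; rewrite ?unfold_in; first by apply/asboolP; constructor.
by move=> /asboolP hx /asboolP hy; apply/asboolP; constructor.
Qed.
HB.instance Definition _ :=
  GRing.isZmodClosed.Build {freeg {ffun I -> A} / int} tens_rel tens_rel_closed.

(* The tensor product over Z of copies of A indexed by I: the free abelian
   group on I-indexed families, modulo additivity in each variable. *)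
Definition tens : zmodType := Quotient.quot tens_rel.

Definition pure f : tens := \pi_(Quotient.quot tens_rel) << f >>.

Lemma tens_eqP (x y : {freeg {ffun I -> A} / int}) :
  gen multilin (x - y) <->
  \pi_(Quotient.quot tens_rel) x = \pi_(Quotient.quot tens_rel) y.
Proof.
split=> [h|/eqP]; last by rewrite -Quotient.idealrBE => /asboolP.
by apply/eqP; rewrite -Quotient.idealrBE; apply/asboolP.
Qed.

(* [gr m a] reads: a is homogeneous of degree m in A. *)
Definition tens_deg (gr : nat -> A -> Prop) (j : nat) : tens -> Prop :=
  gen (fun x => exists (m : I -> nat) f,
         [/\ forall i, gr (m i) (f i), (\sum_i m i)%N = j & x = pure f]).
End Tensor.

Section TensorMap.
Variables (A : comNzRingType) (I J : finType) (p : I -> J).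

Definition push (f : {ffun I -> A}) : {ffun J -> A} :=
  [ffun j => \prod_(i | p i == j) f i].

Definition free_push (z : {freeg {ffun I -> A} / int}) :
    {freeg {ffun J -> A} / int} :=
  fglift (fun f => << push f >>) z.

(* The additive map sending a pure tensor with factors a_i to the pure tensor
   whose factor at j is the product of the a_i with p i = j. *)
Definition tens_map (x : tens A I) : tens A J :=
  \pi_(Quotient.quot (@tens_rel A J)) (free_push (repr x)).

Lemma free_pushB : {morph free_push : x y / x - y}.
Proof. exact: lift_is_additive. Qed.
HB.instance Definition _ := GRing.isZmodMorphism.Build
  {freeg {ffun I -> A} / int} {freeg {ffun J -> A} / int} free_push free_pushB.

Lemma free_pushU f : free_push << f >> = << push f >>.
Proof. by rewrite /free_push liftU scale1r. Qed.

Lemma push_upd f i a :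
  push (upd f i a) = upd (push f) (p i)
                         (a * \prod_(k | (p k == p i) && (k != i)) f k).
Proof.
apply/ffunP=> j; rewrite !ffunE; case: eqP => [->|/eqP ji].
  rewrite (bigD1 i) //= ffunE eqxx; congr (_ * _).
  by apply: eq_bigr => k /andP[_ /negbTE ki]; rewrite ffunE ki.
apply: eq_bigr => k /eqP pk; rewrite ffunE; case: eqP => // ki.
by rewrite -pk ki eqxx in ji.
Qed.

Lemma free_push_rel z : gen (@multilin A I) z -> gen (@multilin A J) (free_push z).
Proof.
elim=> [||x y _ hx _ hy]; last 1 first.
- by rewrite free_pushB; constructor.
- by rewrite raddf0; constructor.
move=> _ [f [i [a [b ->]]]]; rewrite !free_pushB !free_pushU !push_upd mulrDl.
by apply: gen_in; do 4!eexists.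
Qed.

Lemma tens_map_pi z :
  tens_map (\pi_(Quotient.quot (@tens_rel A I)) z) =
  \pi_(Quotient.quot (@tens_rel A J)) (free_push z).
Proof.
apply/tens_eqP; rewrite -free_pushB; apply: free_push_rel.
by apply/tens_eqP; rewrite reprK.
Qed.

Lemma tens_map_pure f : tens_map (pure f) = pure (push f).
Proof. by rewrite tens_map_pi free_pushU. Qed.

Lemma tens_mapB : {morph tens_map : x y / x - y}.
Proof.
move=> x y; rewrite -[x]reprK -[y]reprK -raddfB !tens_map_pi free_pushB.
by rewrite raddfB.
Qed.

HB.instance Definition _ :=
  GRing.isZmodMorphism.Build (tens A I) (tens A J) tens_map tens_mapB.
End TensorMap.

Section GraphCohomology.
Variables (V E : finType) (ends : E -> V * V) (le : rel E).
Variables (A : comNzRingType) (gr : nat -> A -> Prop).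
Implicit Types (s : {set E}) (e : E) (i j : nat).

Definition adj s : rel V :=
  fun u v => [exists e in s, (ends e == (u, v)) || (ends e == (v, u))].

Lemma adj_connect_sym s : connect_sym (adj s).
Proof.
by apply: sym_connect_sym => u v; apply: eq_existsb => e; rewrite orbC.
Qed.

(* A connected component is given by its representative in [fingraph]. *)
Definition comp s : finType := {v : V | v \in roots (adj s)}.

Definition comp_of s (v : V) : comp s :=
  exist _ (fingraph.root (adj s) v) (roots_root (adj_connect_sym s) v).

Definition Phi s : zmodType := tens A (comp s).

(* For s \subset s', every component of s lies in a component of s'. When s' is
   s plus one edge, this merges two components, multiplying their factors, or
   is a bijection of components, and then the map is the identity. *)
Definition Phi_map s s' : Phi s -> Phi s' :=
  tens_map (fun c : comp s => comp_of s' (val c)).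
HB.instance Definition _ s s' := GRing.Additive.on (@Phi_map s s').

Definition graph_complex : zmodType := {dffun forall s : {set E}, Phi s}.

Definition sgn_exp s e : nat := #|[set f in s | le f e && (f != e)]|.

(* The component at s of the image collects the contributions of all the
   s :\ e with e \in s. *)
Definition graph_diff (x : graph_complex) : graph_complex :=
  [ffun s => (\sum_(e in s)
     @Phi_map (s :\ e) s (x (s :\ e)) *~ (-1) ^+ sgn_exp (s :\ e) e) : Phi s].

Lemma graph_diffB : {morph graph_diff : x y / x - y}.
Proof.
move=> x y; apply/ffunP=> s; rewrite dsumBE !ffunE -sumrB.
by apply: eq_bigr => e _; rewrite -mulrzBl -raddfB dsumBE.
Qed.
HB.instance Definition _ :=
  GRing.isZmodMorphism.Build graph_complex graph_complex graph_diff graph_diffB.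

Lemma root_adj_sub s s' v : s \subset s' ->
  fingraph.root (adj s') (fingraph.root (adj s) v) = fingraph.root (adj s') v.
Proof.
move=> ss'; apply/eqP; rewrite eq_sym root_connect; last exact: adj_connect_sym.
apply: connect_sub (connect_root (adj s) v) => u w /existsP[e /andP[es h]].
by apply: connect1; apply/existsP; exists e; rewrite (subsetP ss').
Qed.

Lemma push_comp s1 s2 s3 (f : {ffun comp s1 -> A}) : s2 \subset s3 ->
  push (fun c : comp s2 => comp_of s3 (val c))
       (push (fun c : comp s1 => comp_of s2 (val c)) f)
  = push (fun c : comp s1 => comp_of s3 (val c)) f.
Proof.
move=> s23; apply/ffunP=> c; rewrite !ffunE.
rewrite (partition_big (fun b : comp s1 => comp_of s2 (val b))
           (fun b : comp s2 => comp_of s3 (val b) == c)) /=.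
  apply: eq_bigr => b /eqP bc; rewrite ffunE; apply: eq_bigl => a.
  case: (comp_of s2 (val a) =P b) => [ab|]; last by rewrite andbF.
  rewrite andbT -bc -ab; apply/esym/eqP/val_inj => /=.
  by rewrite root_adj_sub.
move=> a /eqP <-; apply/eqP/val_inj => /=.
by rewrite root_adj_sub.
Qed.

Lemma Phi_map_comp s1 s2 s3 (x : Phi s1) : s2 \subset s3 ->
  @Phi_map s2 s3 (@Phi_map s1 s2 x) = @Phi_map s1 s3 x.
Proof.
move=> s23; rewrite -[x]reprK; move: (repr x) => {x} z.
rewrite /Phi_map (tens_map_pi (fun c => comp_of s2 (val c)) z).
rewrite (tens_map_pi (fun c => comp_of s3 (val c)) z) tens_map_pi.
congr (\pi_(_) _).
rewrite -(freeg_sumE z) !raddf_sum; apply: eq_bigr => f _.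
have Uz (I J : finType) (p : I -> J) (g : {ffun I -> A}) (c : int) :
  free_push p << c *g g >> = << c *g push p g >>.
  rewrite /free_push liftU; apply/eqP/freeg_eqP => y.
  by rewrite coeffZ !coeffU mul1r.
by rewrite /= !Uz push_comp.
Qed.

Lemma graph_diffK (x : graph_complex) :
  antisymmetric le -> total le -> graph_diff (graph_diff x) = 0.
Proof.
move=> anti tot; apply/ffunP=> s; rewrite dsum0E ffunE.
pose F e f : Phi s :=
  @Phi_map (s :\ e :\ f) s (x (s :\ e :\ f))
    *~ ((-1) ^+ sgn_exp (s :\ e :\ f) f * (-1) ^+ sgn_exp (s :\ e) e).
transitivity (\sum_(e in s) \sum_(f in s | f != e) F e f).
  apply: eq_bigr => e es; rewrite ffunE raddf_sum /= mulrz_suml.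
  apply: eq_big => [f|f fs]; first by rewrite !inE andbC.
  by rewrite raddfMz /= Phi_map_comp ?subD1set // -mulrzA.
pose lt e f := le e f && (e != f).
have ltN e f : e != f -> lt f e = ~~ lt e f.
  move=> ef; rewrite /lt ef eq_sym ef !andbT.
  have := tot e f; case: (boolP (le e f)) => //= h1 _.
  by apply/negP => h2; move: ef; rewrite (anti e f) ?eqxx // h1.
have split e : \sum_(f in s | f != e) F e f =
    \sum_(f in s | lt f e) F e f + \sum_(f in s | lt e f) F e f.
  rewrite (bigID (fun f => lt f e)) /=; congr (_ + _); apply: eq_bigl => f.
    by rewrite /lt; case: (f != e); rewrite ?andbT ?andbF.
  case: (eqVneq f e) => [->|fe]; first by rewrite /lt eqxx !andbF.
  by rewrite andbT (ltN f e).
under eq_bigr do rewrite split.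
rewrite big_split /= [X in _ + X](exchange_big_dep (mem s)) /=; last first.
  by move=> e f _ /andP[].
rewrite -big_split big1 //= => e es; rewrite [X in _ + X](eq_bigl (fun f =>
  (f \in s) && lt f e)) => [|f]; last by rewrite es.
rewrite -big_split big1 //= => f /andP[fs fe].
have ef : f != e by case/andP: fe.
have nef : lt e f = false by rewrite ltN // fe.
have tE a b : a \in s -> a != b ->
    sgn_exp (s :\ b) b = (lt a b + sgn_exp (s :\ b :\ a) b)%N.
  move=> as_ ab; rewrite /sgn_exp [LHS](cardsD1 a) !inE as_ ab /=.
  rewrite /lt ab; congr (_ + _)%N; apply: eq_card => c; rewrite !inE.
  by rewrite !andbA.
have E2 : s :\ f :\ e = s :\ e :\ f by rewrite !setDDl setUC.
have ef' : e != f by rewrite eq_sym.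
rewrite /F E2 -mulrzDr (tE f e fs ef) (tE e f es ef') E2 fe nef /=.
by rewrite exprS mulN1r mulrN [X in _ + X]mulrC addNr mulr0z.
Qed.

Definition in_chain i j (x : graph_complex) : Prop :=
  forall s, if #|s| == i then tens_deg gr j (x s) else x s = 0.

Lemma in_chain0 i j : in_chain i j 0.
Proof. by move=> s; rewrite dsum0E; case: ifP => _ //; constructor. Qed.

Lemma in_chainB i j x y :
  in_chain i j x -> in_chain i j y -> in_chain i j (x - y).
Proof.
move=> hx hy s; move: (hx s) (hy s); rewrite dsumBE.
by case: ifP => _; [constructor | move=> -> ->; rewrite subr0].
Qed.

Definition cocycle i j : {pred graph_complex} :=
  fun x => `[< in_chain i j x /\ graph_diff x = 0 >].

Lemma cocycle_closed i j : zmod_closed (cocycle i j).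
Proof.
split=> [|x y]; rewrite ?unfold_in.
  by apply/asboolP; rewrite raddf0; split=> //; apply: in_chain0.
move=> /asboolP[hx dx] /asboolP[hy dy]; apply/asboolP.
by rewrite graph_diffB dx dy subr0; split=> //; apply: in_chainB.
Qed.
HB.instance Definition _ i j :=
  GRing.isZmodClosed.Build graph_complex (cocycle i j) (cocycle_closed i j).

Record Zgroup (i j : nat) := MkZ { Zval : graph_complex; _ : Zval \in cocycle i j }.
HB.instance Definition _ i j := [isSub of Zgroup i j for @Zval i j].
HB.instance Definition _ i j := [Choice of Zgroup i j by <:].
HB.instance Definition _ i j := [SubChoice_isSubZmodule of Zgroup i j by <:].

Definition is_coboundary i j (x : graph_complex) : Prop :=
  if i is i'.+1 then exists2 y, in_chain i' j y & x = graph_diff y else x = 0.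

Definition coboundary i j : {pred Zgroup i j} :=
  fun z => `[< is_coboundary i j (Zval z) >].

Lemma coboundary_closed i j : zmod_closed (@coboundary i j).
Proof.
split=> [|z1 z2]; rewrite ?unfold_in.
  apply/asboolP; rewrite [Zval 0](raddf0 val).
  by case: i => //= i; exists 0; rewrite ?raddf0 //; apply: in_chain0.
move=> /asboolP h1 /asboolP h2; apply/asboolP; rewrite [Zval _](raddfB val) /=.
case: i z1 z2 h1 h2 => [|i] z1 z2 /=; first by move=> -> ->; rewrite subr0.
case=> y1 hy1 -> [y2 hy2 ->]; exists (y1 - y2); last by rewrite raddfB.
exact: in_chainB.
Qed.
HB.instance Definition _ i j :=
  GRing.isZmodClosed.Build (Zgroup i j) (@coboundary i j) (@coboundary_closed i j).

Definition cohomology i j : zmodType := Quotient.quot (@coboundary i j).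
End GraphCohomology.

(* The n-gon: edge k joins k and k + 1 mod n (for n = 2, two parallel edges). *)
Definition polygon (n : nat) (k : 'I_n) : 'I_n * 'I_n := (k, ordS k).

Definition deg_Zx (m : nat) (p : {poly int}) : Prop := exists c, p = c *: 'X^m.

(* H^{i,j} of the n-gon with coefficients in Z[x], for the order le on edges. *)
Definition H_polygon (n : nat) (le : rel 'I_n) (i j : nat) : zmodType :=
  cohomology (@polygon n) le deg_Zx i j.

Record fps (R : Type) := Fps { fcoef : nat -> R }.

HB.instance Definition _ (R : Type) := [isNew for @fcoef R].
HB.instance Definition _ (R : choiceType) := [Choice of fps R by <:].

Lemma fpsP (R : Type) (f g : fps R) : fcoef f =1 fcoef g -> f = g.
Proof. by case: f g => [f] [g] /= /funext ->. Qed.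

Section FpsRing.
Variable R : comNzRingType.
Implicit Types f g h : fps R.

Definition fps_zero : fps R := Fps (fun=> 0).
Definition fps_opp f : fps R := Fps (fun k => - fcoef f k).
Definition fps_add f g : fps R := Fps (fun k => fcoef f k + fcoef g k).
Definition fps_one : fps R := Fps (fun k => (k == 0%N)%:R).
Definition fps_mul f g : fps R :=
  Fps (fun k => \sum_(i < k.+1) fcoef f i * fcoef g (k - i)).

Lemma fps_addA : associative fps_add.
Proof. by move=> f g h; apply/fpsP=> k /=; rewrite addrA. Qed.
Lemma fps_addC : commutative fps_add.
Proof. by move=> f g; apply/fpsP=> k /=; rewrite addrC. Qed.
Lemma fps_add0 : left_id fps_zero fps_add.
Proof. by move=> f; apply/fpsP=> k /=; rewrite add0r. Qed.
Lemma fps_addN : left_inverse fps_zero fps_opp fps_add.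
Proof. by move=> f; apply/fpsP=> k /=; rewrite addNr. Qed.
HB.instance Definition _ := GRing.isZmodule.Build (fps R)
  fps_addA fps_addC fps_add0 fps_addN.

Definition fps_trunc k f : {poly R} := \poly_(i < k.+1) fcoef f i.

Lemma fps_mulE f g k l : (l <= k)%N ->
  fcoef (fps_mul f g) l = (fps_trunc k f * fps_trunc k g)`_l.
Proof.
move=> lk; rewrite coefM /=; apply: eq_bigr => i _; rewrite !coef_poly.
have il : (i <= l)%N by rewrite -ltnS.
by rewrite !ltnS (leq_trans il lk) (leq_trans (leq_subr _ _) lk).
Qed.

Lemma fps_mulA : associative fps_mul.
Proof.
move=> f g h; apply/fpsP=> k; set F := fps_trunc k.
transitivity ((F f * (F g * F h))`_k).
  rewrite coefM; apply: eq_bigr => i _.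
  rewrite (@fps_mulE g h k) ?leq_subr //.
  by rewrite coef_poly ltn_ord.
rewrite mulrA coefM; apply: eq_bigr => i _.
rewrite (@fps_mulE f g k) -1?ltnS //.
by rewrite coef_poly ltnS leq_subr.
Qed.
Lemma fps_mulC : commutative fps_mul.
Proof.
by move=> f g; apply/fpsP=> k; rewrite !(@fps_mulE _ _ k k) // mulrC.
Qed.
Lemma fps_mul1 : left_id fps_one fps_mul.
Proof.
move=> f; apply/fpsP=> k /=; rewrite big_ord_recl /= subn0 mul1r.
by rewrite big1 ?addr0 // => i _; rewrite mul0r.
Qed.
Lemma fps_mulD : left_distributive fps_mul fps_add.
Proof.
move=> f g h; apply/fpsP=> k /=; rewrite -big_split.
by apply: eq_bigr => i _; rewrite mulrDl.
Qed.
Lemma fps_one_neq0 : fps_one != fps_zero.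
Proof.
by apply/eqP=> /(congr1 (fun f => fcoef f 0)) /= /eqP; rewrite oner_eq0.
Qed.
HB.instance Definition _ := GRing.Zmodule_isComNzRing.Build (fps R)
  fps_mulA fps_mulC fps_mul1 fps_mulD fps_one_neq0.

Lemma fcoefM f g k :
  fcoef (f * g) k = \sum_(i < k.+1) fcoef f i * fcoef g (k - i).
Proof. by []. Qed.

Lemma fcoefB f g k : fcoef (f - g) k = fcoef f k - fcoef g k.
Proof. by []. Qed.

Lemma fcoef_sum (I : Type) (r : seq I) (P : pred I) (F : I -> fps R) k :
  fcoef (\sum_(i <- r | P i) F i) k = \sum_(i <- r | P i) fcoef (F i) k.
Proof. exact: (big_morph (fun f => fcoef f k)). Qed.

Definition fpsC (c : R) : fps R := Fps (fun k => if k == 0%N then c else 0).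
Definition fpsX : fps R := Fps (fun k => (k == 1%N)%:R).

(* X + X^2 + X^3 + ... *)
Definition fps_pos : fps R := Fps (fun k => (0 < k)%N%:R).

Lemma fcoefCM c f k : fcoef (fpsC c * f) k = c * fcoef f k.
Proof.
rewrite fcoefM big_ord_recl /= subn0 big1 ?addr0 // => i _.
by rewrite mul0r.
Qed.

Lemma fcoef_expr_low u m k : fcoef u 0 = 0 -> (k < m)%N -> fcoef (u ^+ m) k = 0.
Proof.
move=> u0; elim: m k => // m IH k km; rewrite exprS fcoefM big1 // => i _.
case: i => -[|i] /= ik; first by rewrite u0 mul0r.
rewrite IH ?mulr0 //; move: ik km; rewrite !ltnS => ik km.
by apply: leq_trans km; rewrite ltn_subrL (leq_ltn_trans _ ik).
Qed.
End FpsRing.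

Section FpsUnitRing.
Variable R : comUnitRingType.
Implicit Types f g : fps R.

Definition fps_unit : {pred fps R} := fun f => fcoef f 0 \is a GRing.unit.

(* With f = f_0 (1 - u), the inverse is f_0^-1 (1 + u + u^2 + ...). *)
Definition fps_inv f : fps R :=
  if f \in fps_unit then
    Fps (fun k => (fcoef f 0)^-1 *
           \sum_(m < k.+1) fcoef ((1 - fpsC (fcoef f 0)^-1 * f) ^+ m) k)
  else f.

Lemma fps_mulV : {in fps_unit, left_inverse 1 fps_inv *%R}.
Proof.
move=> f fU; rewrite /fps_inv fU; move: fU; rewrite unfold_in => fU.
set a := fcoef f 0 in fU *; set u := 1 - fpsC a^-1 * f.
have u0 : fcoef u 0 = 0.
  by rewrite fcoefB fcoefCM mulVr // subrr.
have fE : f = fpsC a * (1 - u).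
  apply/fpsP=> k; rewrite fcoefCM /u opprB addrC subrK fcoefCM.
  by rewrite mulrA divrr // mul1r.
have key k : forall l, (l <= k)%N ->
    a^-1 * \sum_(m < l.+1) fcoef (u ^+ m) l
    = fcoef (fpsC a^-1 * \sum_(m < k.+1) u ^+ m) l.
  move=> l lk; rewrite fcoefCM fcoef_sum; congr (_ * _).
  rewrite -!(big_mkord xpredT (fun m => fcoef (u ^+ m) l)).
  rewrite [RHS](big_cat_nat (n := l.+1)) //= [X in _ + X]big1_seq ?addr0 //.
  move=> m /=; rewrite mem_index_iota => /andP[lm _].
  exact: fcoef_expr_low.
apply/fpsP=> k; rewrite fcoefM /=.
transitivity (fcoef (fpsC a^-1 * (\sum_(m < k.+1) u ^+ m) * f) k).
  rewrite fcoefM; apply: eq_bigr => i _; congr (_ * _).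
  by apply: key; rewrite -ltnS.
rewrite {1}fE.
have -> : fpsC a^-1 * (\sum_(m < k.+1) u ^+ m) * (fpsC a * (1 - u))
          = fpsC a^-1 * (fpsC a * ((1 - u) * \sum_(m < k.+1) u ^+ m)).
  by rewrite -mulrA; congr (_ * _); rewrite mulrC -mulrA.
rewrite !fcoefCM mulrA mulVr // mul1r.
rewrite -opprB mulNr -subrX1 opprB.
by rewrite fcoefB fcoef_expr_low // subr0.
Qed.

Lemma fps_unitP f g : g * f = 1 -> f \in fps_unit.
Proof.
move=> /(congr1 (fun h => fcoef h 0)); rewrite fcoefM big_ord1 /= => h.
by rewrite unfold_in; apply/unitrPr; exists (fcoef g 0); rewrite mulrC.
Qed.

Lemma fps_inv_out : {in [predC fps_unit], fps_inv =1 id}.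
Proof. by move=> f; rewrite inE /fps_inv => /negbTE ->. Qed.

HB.instance Definition _ := GRing.ComNzRing_hasMulInverse.Build (fps R)
  fps_mulV fps_unitP fps_inv_out.
End FpsUnitRing.

(* Main.v *)
(* With coefficients in Z[x], the group attached to an edge set s is
   R/(x_u - x_v : u and v connected in s), where R = Z[x_0, ..., x_(n-1)], and
   the maps of the complex are the projections.  Choosing in each arc its last
   vertex as representative variable turns cochains into polynomials.

   Let T_k be the set of the last k edges.  Killing one after the other, by
   explicit homotopies, the edges 0, ..., n-k-2 of the cochains that contain T_k
   but not the edge n-k-1 shows that every cocycle of degree i is cohomologous
   to one supported at T_i, that is, to a polynomial P in x_0, ..., x_r with
   r = n-1-i that vanishes under x_v := x_(v+1) for v < r and under x_r := x_0.
   For r >= 2, P is a multiple of all the linear forms x_v - x_(v+1) and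
   x_r - x_0.  In degree 0 this describes the cohomology.  In degree i > 0,
   replacing the factor x_r - x_0 by x_r - x_(r+1) gives a preimage of P
   supported at T_(i-1).  For r = 1 (degree n-2) the two linear forms coincide
   up to sign, P = (x_0 - x_1) Q, and P is a coboundary if and only if it is a
   multiple of (x_0 - x_1)^2, so that Q(x, x) is a complete invariant. *)

Require Import Defs.
From HB Require Import structures.
From mathcomp Require Import all_boot all_order all_algebra.
From mathcomp Require Import generic_quotient ring_quotient.
From mathcomp Require Import boolp.
From mathcomp.multinomials Require Import freeg mpoly.
From mathcomp Require Import zify ring.

Set Implicit Arguments.
Unset Strict Implicit.
Unset Printing Implicit Defensive.

Import GRing.Theory.
Local Open Scope ring_scope.
Local Open Scope quotient_scope.

(** * Tensor powers of Z[x] and polynomials *)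

Section TensorInduction.
Variables (A : comNzRingType) (I : finType).

(** The tensor power is a quotient of a free abelian group, so pure tensors span it; sums and
    integer multiples are obtained from differences. *)
Lemma tens_ind (Q : tens A I -> Prop) :
  Q 0 -> (forall f, Q (pure f)) -> (forall x y, Q x -> Q y -> Q (x - y)) ->
  forall x, Q x.
Proof.
move=> Q0 Qf QB x.
have QN y : Q y -> Q (- y) by move=> Qy; rewrite -sub0r; apply: QB.
have QD y z : Q y -> Q z -> Q (y + z).
  by move=> Qy Qz; rewrite -[z]opprK; apply: QB => //; apply: QN.
have Qn y k : Q y -> Q (y *+ k).
  by move=> Qy; elim: k => [|k IH]; rewrite ?mulr0n ?mulrS //; apply: QD.
rewrite -[x]reprK; move: (repr x) => {x} z.
rewrite -(freeg_sumE z) raddf_sum.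
elim/big_ind: _ => // f _.
have -> : << coeff f z *g f >> = << f >> *~ coeff f z :> {freeg _ / int}.
  by rewrite -scaler_int; apply/eqP/freeg_eqP => y; rewrite coeffZ !coeffU intz; ring.
rewrite raddfMz; case: (coeff f z) => k; rewrite ?NegzE ?mulrNz -pmulrn.
  exact: (Qn (pure f)).
by apply: QN; apply: (Qn (pure f)).
Qed.

Lemma pure_updB (f : {ffun I -> A}) i a b :
  pure (upd f i (a - b)) = pure (upd f i a) - pure (upd f i b).
Proof.
rewrite /pure -raddfB; apply/esym/tens_eqP.
rewrite -{1}(subrK b a).
set z := _ - _ - _.
have -> : z = << upd f i (a - b + b) >> - << upd f i (a - b) >> - << upd f i b >>.
  by rewrite /z addrAC.
by apply: gen_in; exists f, i, (a - b), b.
Qed.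

Lemma upd_id (f : {ffun I -> A}) i : upd f i (f i) = f.
Proof. by apply/ffunP => k; rewrite ffunE; case: eqP => // ->. Qed.
End TensorInduction.

Lemma tens_map_id (A : comNzRingType) (I : finType) (p : I -> I) (x : tens A I) :
  p =1 id -> tens_map p x = x.
Proof.
move=> pE; elim/tens_ind: x => [|f|x y hx hy]; rewrite ?raddf0 ?raddfB /= ?hx ?hy //.
rewrite tens_map_pure; congr pure; apply/ffunP => i; rewrite ffunE.
by rewrite (eq_bigl (pred1 i)) ?big_pred1_eq // => k; rewrite pE.
Qed.

Lemma tens_map_comp (A : comNzRingType) (I J K : finType) (p : I -> J)
    (q : J -> K) (x : tens A I) :
  tens_map q (tens_map p x) = tens_map (q \o p) x.
Proof.
elim/tens_ind: x => [|f|x y hx hy]; rewrite ?raddf0 ?raddfB /= ?hx ?hy //.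
rewrite !tens_map_pure; congr pure; apply/ffunP => k; rewrite !ffunE.
rewrite (partition_big p (fun j => q j == k)) /=; last by move=> i /eqP <-.
apply: eq_bigr => j /eqP jk; rewrite ffunE; apply: eq_bigl => i.
by case: (p i =P j) => [->|]; rewrite ?jk ?eqxx ?andbF.
Qed.

Lemma eq_tens_map (A : comNzRingType) (I J : finType) (p q : I -> J)
    (x : tens A I) : p =1 q -> tens_map p x = tens_map q x.
Proof.
move=> pq; elim/tens_ind: x => [|f|x y hx hy]; rewrite ?raddf0 ?raddfB /= ?hx ?hy //.
rewrite !tens_map_pure; congr pure; apply/ffunP => k; rewrite !ffunE.
by apply: eq_bigl => i; rewrite pq.
Qed.

Definition mono_fun (I : finType) (m : I -> nat) : {ffun I -> {poly int}} :=
  [ffun i => 'X^(m i)].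

Lemma tens_mono_ind (I : finType) (Q : tens {poly int} I -> Prop) :
  Q 0 -> (forall m, Q (pure (mono_fun m))) ->
  (forall x y, Q x -> Q y -> Q (x - y)) -> forall x, Q x.
Proof.
move=> Q0 Qm QB; apply: tens_ind => // f.
have QN y : Q y -> Q (- y) by move=> Qy; rewrite -sub0r; apply: QB.
have QD y z : Q y -> Q z -> Q (y + z).
  by move=> Qy Qz; rewrite -[z]opprK; apply: QB => //; apply: QN.
have Qn y k : Q y -> Q (y *+ k).
  by move=> Qy; elim: k => [|k IH]; rewrite ?mulr0n ?mulrS //; apply: QD.
have Qz y (k : int) : Q y -> Q (y *~ k).
  by case: k => k Qy; rewrite ?NegzE ?mulrNz -pmulrn; [|apply: QN]; apply: Qn.
(* Outside the list, all factors are powers of X. The list starts full and is emptied one coordinate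
   at a time, by additivity in that factor. *)
have: forall i, i \notin enum I -> exists k, f i = 'X^k.
  by move=> i; rewrite mem_enum.
elim: (enum I) f => [|i s IH] f hf.
  have /choice[m hm] i : exists k, f i = 'X^k by apply: hf.
  suff -> : f = mono_fun m by [].
  by apply/ffunP => i; rewrite ffunE hm.
pose ph a := pure (upd f i a).
have phB : {morph ph : a b / a - b} by move=> a b; apply: pure_updB.
have ph0 : ph 0 = 0 by have := phB 0 0; rewrite !subrr.
have phN a : ph (- a) = - ph a by rewrite -(sub0r a) phB ph0 sub0r.
have phD a b : ph (a + b) = ph a + ph b by rewrite -{1}[b]opprK phB phN opprK.
have phn a k : ph (a *+ k) = ph a *+ k.
  by elim: k => [|k h]; rewrite ?mulr0n // !mulrS phD h.
rewrite -(upd_id f i) -/(ph _) -[f i]coefK poly_def.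
elim/big_ind: _ => [|a b|k _]; rewrite ?ph0 ?phD //; first exact: QD.
have -> : ph ((f i)`_k *: 'X^k) = ph 'X^k *~ (f i)`_k.
  rewrite -{1}[(f i)`_k]intz scaler_int; case: ((f i)`_k) => l.
    by rewrite -pmulrn phn.
  by rewrite NegzE !mulrNz -!pmulrn phN phn.
apply: Qz; apply: IH => j js; rewrite ffunE; case: eqP => [_|/eqP ji].
  by exists k.
by apply: hf; rewrite inE negb_or ji.
Qed.

(** * The tensor power as a polynomial ring in n variables *)

Section TensorPoly.
Variable n : nat.
Implicit Types (P Q : {mpoly int[n]}) (f : {ffun 'I_n -> {poly int}}).

Lemma mpoly_mono_ind (Q : {mpoly int[n]} -> Prop) :
  Q 0 -> (forall m, Q 'X_[m]) -> (forall x y, Q x -> Q y -> Q (x - y)) ->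
  forall P, Q P.
Proof.
move=> Q0 Qm QB P.
have QN y : Q y -> Q (- y) by move=> Qy; rewrite -sub0r; apply: QB.
have QD y z : Q y -> Q z -> Q (y + z).
  by move=> Qy Qz; rewrite -[z]opprK; apply: QB => //; apply: QN.
have Qn y k : Q y -> Q (y *+ k).
  by move=> Qy; elim: k => [|k IH]; rewrite ?mulr0n ?mulrS //; apply: QD.
rewrite [P]mpolyE; elim/big_ind: _ => // m _.
rewrite -[P@_m]intz scaler_int; case: (P@_m) => k.
  by rewrite -pmulrn; apply: Qn.
by rewrite NegzE mulrNz -pmulrn; apply: QN; apply: Qn.
Qed.

Definition free_mono P : {freeg {ffun 'I_n -> {poly int}} / int} :=
  fglift (fun m : 'X_{1..n} => << mono_fun m >>) (mpoly_val P).

Lemma free_monoB : {morph free_mono : P Q / P - Q}.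
Proof. by move=> P Q; rewrite -lift_is_additive. Qed.
HB.instance Definition _ := GRing.isZmodMorphism.Build
  {mpoly int[n]} {freeg {ffun 'I_n -> {poly int}} / int} free_mono free_monoB.

(** One direction of the isomorphism with Z[x_0, ..., x_(n-1)]: a monomial goes to the pure tensor
    of its powers. The inverse [psi] evaluates the factor at [i] in the variable x_i. *)
Definition theta P : tens {poly int} 'I_n :=
  \pi_(Quotient.quot (@tens_rel {poly int} 'I_n)) (free_mono P).

Lemma thetaB : {morph theta : P Q / P - Q}.
Proof. by move=> P Q; rewrite /theta free_monoB raddfB. Qed.
HB.instance Definition _ := GRing.isZmodMorphism.Build
  {mpoly int[n]} (tens {poly int} 'I_n) theta thetaB.

Lemma thetaX (m : 'X_{1..n}) : theta 'X_[m] = pure (mono_fun m).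
Proof.
rewrite /theta /free_mono /pure; congr (\pi_(_) _).
by rewrite unlock liftU scale1r.
Qed.

Definition eval_var (i : 'I_n) (p : {poly int}) : {mpoly int[n]} :=
  (map_poly (@mpolyC n int) p).['X_i].

Lemma eval_varD i : {morph eval_var i : p q / p + q}.
Proof. by move=> p q; rewrite /eval_var rmorphD hornerD. Qed.

Lemma eval_varZXn i c k : eval_var i (c *: 'X^k) = c *: 'X_i ^+ k.
Proof.
rewrite /eval_var map_polyZ map_polyXn hornerZ hornerXn.
by rewrite mul_mpolyC.
Qed.

Lemma eval_varXn i k : eval_var i 'X^k = 'X_i ^+ k.
Proof. by rewrite -[in LHS](scale1r 'X^k) eval_varZXn scale1r. Qed.

Definition eval_fun f : {mpoly int[n]} := \prod_i eval_var i (f i).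

Lemma eval_fun_upd f i a :
  eval_fun (upd f i a) = eval_var i a * \prod_(k | k != i) eval_var k (f k).
Proof.
rewrite /eval_fun (bigD1 i) //= ffunE eqxx; congr (_ * _).
by apply: eq_bigr => k ki; rewrite ffunE (negbTE ki).
Qed.

Definition free_eval (z : {freeg {ffun 'I_n -> {poly int}} / int}) :=
  fglift eval_fun z.

Lemma free_evalB : {morph free_eval : x y / x - y}.
Proof. exact: lift_is_additive. Qed.
HB.instance Definition _ := GRing.isZmodMorphism.Build
  {freeg {ffun 'I_n -> {poly int}} / int} {mpoly int[n]} free_eval free_evalB.

Lemma free_eval_rel z : gen (@multilin {poly int} 'I_n) z -> free_eval z = 0.
Proof.
elim=> [|_ [f [i [a [b ->]]]]|x y _ hx _ hy]; last 1 first.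
- by rewrite free_evalB hx hy subrr.
- by rewrite raddf0.
rewrite !free_evalB /free_eval !liftU !scale1r !eval_fun_upd eval_varD.
by ring.
Qed.

Definition psi (x : tens {poly int} 'I_n) : {mpoly int[n]} := free_eval (repr x).

Lemma psi_pi z : psi (\pi_(Quotient.quot (@tens_rel {poly int} 'I_n)) z) = free_eval z.
Proof.
apply/eqP; rewrite -subr_eq0 -free_evalB; apply/eqP; apply: free_eval_rel.
by apply/tens_eqP; rewrite reprK.
Qed.

Lemma psiB : {morph psi : x y / x - y}.
Proof. by move=> x y; rewrite -[x]reprK -[y]reprK -raddfB !psi_pi free_evalB. Qed.
HB.instance Definition _ := GRing.isZmodMorphism.Build
  (tens {poly int} 'I_n) {mpoly int[n]} psi psiB.

Lemma psi_pure f : psi (pure f) = eval_fun f.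
Proof. by rewrite psi_pi /free_eval liftU scale1r. Qed.

Lemma psi_mono (m : 'I_n -> nat) :
  psi (pure (mono_fun m)) = 'X_[[multinom m i | i < n]].
Proof.
rewrite psi_pure mpolyXE_id; apply: eq_bigr => i _.
by rewrite ffunE mnmE eval_varXn.
Qed.

Lemma psiK x : theta (psi x) = x.
Proof.
elim/tens_mono_ind: x => [|m|x y hx hy]; rewrite ?raddf0 ?raddfB /= ?raddfB /= ?hx ?hy //.
rewrite psi_mono thetaX; congr pure; apply/ffunP => i.
by rewrite !ffunE mnmE.
Qed.

Definition sub (p : 'I_n -> 'I_n) : {mpoly int[n]} -> {mpoly int[n]} :=
  mmap (@mpolyC n int) (fun i => 'X_(p i)).
HB.instance Definition _ p := GRing.RMorphism.on (sub p).

Lemma subX p i : sub p 'X_i = 'X_(p i).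
Proof. by rewrite /sub mmapX mmap1U. Qed.

Lemma subXm p m : sub p 'X_[m] = \prod_i 'X_(p i) ^+ m i.
Proof. by rewrite /sub mmapX. Qed.

Lemma eq_sub p q P : p =1 q -> sub p P = sub q P.
Proof.
move=> pq; elim/mpoly_mono_ind: P => [|m|x y hx hy];
  rewrite ?raddf0 ?raddfB /= ?hx ?hy //.
by rewrite !subXm; apply: eq_bigr => i _; rewrite pq.
Qed.

Lemma sub_comp p q P : sub q (sub p P) = sub (q \o p) P.
Proof.
elim/mpoly_mono_ind: P => [|m|x y hx hy];
  rewrite ?raddf0 ?raddfB /= ?hx ?hy //.
rewrite !subXm rmorph_prod; apply: eq_bigr => i _.
by rewrite rmorphXn /= subX.
Qed.

Lemma sub_id p P : p =1 id -> sub p P = P.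
Proof.
move=> pE; elim/mpoly_mono_ind: P => [|m|x y hx hy];
  rewrite ?raddf0 ?raddfB /= ?hx ?hy //.
by rewrite subXm [RHS]mpolyXE_id; apply: eq_bigr => i _; rewrite pE.
Qed.

(** Multiplying the factors that [p] sends to the same place amounts to identifying their
    variables. *)
Lemma psi_map_theta p P : psi (tens_map p (theta P)) = sub p P.
Proof.
elim/mpoly_mono_ind: P => [|m|x y hx hy];
  rewrite ?raddf0 ?raddfB /= ?hx ?hy //.
rewrite thetaX tens_map_pure psi_pure /eval_fun subXm.
rewrite [RHS](partition_big p predT) //=; apply: eq_bigr => j _.
rewrite ffunE /eval_var !rmorph_prod horner_prod /=; apply: eq_bigr => i /eqP <-.
by rewrite ffunE -/(eval_var _ _) eval_varXn.
Qed.

End TensorPoly.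

Lemma tens_map_deg (I J : finType) (p : I -> J) j x :
  tens_deg deg_Zx j x -> tens_deg deg_Zx j (tens_map p x).
Proof.
elim=> [|_ [m [f [hf <- ->]]]|y z _ hy _ hz]; first by rewrite raddf0; constructor.
  apply: gen_in; exists (fun k => \sum_(i | p i == k) m i)%N, (push p f).
  split; last by rewrite tens_map_pure.
    move=> k; rewrite ffunE; elim/big_ind2: _ => [|_ a _ b [c1 ->] [c2 ->]|i _] //.
      by exists 1; rewrite scale1r.
    by exists (c1 * c2); rewrite exprD -scalerAl -scalerAr scalerA.
  by rewrite [RHS](partition_big p predT).
by rewrite raddfB; apply: genB.
Qed.

Lemma psi_deg n j (x : tens {poly int} 'I_n) :
  tens_deg deg_Zx j x -> psi x \is j.-homog.
Proof.
elim=> [|_ [m [f [hf <- ->]]]|y z _ hy _ hz]; first by rewrite raddf0 rpred0.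
  rewrite psi_pure /eval_fun; elim/big_rec2: _ => [|i a P _ hP]; first exact: dhomog1.
  apply: dhomogM => //; have [c ->] := hf i; rewrite eval_varZXn.
  by rewrite rpredZ // mpolyXn dhomogX /= mdegMn mdeg1 mul1n.
by rewrite raddfB rpredB.
Qed.

Lemma theta_deg n j (P : {mpoly int[n]}) :
  P \is j.-homog -> tens_deg deg_Zx j (theta P).
Proof.
move=> /dhomogP hP; rewrite [P]mpolyE.
have GD y z : tens_deg deg_Zx j y -> tens_deg deg_Zx j z ->
    tens_deg deg_Zx j (y + z : tens _ 'I_n).
  move=> hy hz; rewrite -[z]opprK; apply: genB => //.
  by rewrite -sub0r; apply: genB => //; constructor.
rewrite raddf_sum big_seq; elim/big_ind: _ => [|y z|m hm]; first by constructor.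
  exact: GD.
have hX : tens_deg deg_Zx j (theta 'X_[m]).
  rewrite thetaX; apply: gen_in; exists m, (mono_fun m); split=> //.
    by move=> i; exists 1; rewrite ffunE scale1r.
  by rewrite -mdegE; apply: hP.
have hn k : tens_deg deg_Zx j (theta 'X_[m] *+ k).
  by elim: k => [|k IH]; [constructor | rewrite mulrS; apply: GD].
rewrite -[P@_m]intz scaler_int raddfMz /=; case: (P@_m) => k.
  by rewrite -pmulrn.
rewrite NegzE mulrNz -pmulrn -[X in tens_deg _ _ X]sub0r.
by apply: genB; [exact: gen0 | exact: hn].
Qed.

(** * Division by products of linear forms *)

Section Division.
Variable n : nat.
Implicit Types (P Q : {mpoly int[n]}) (a b : 'I_n) (p q : 'I_n * 'I_n).

Definition fuse p : 'I_n -> 'I_n := fun u => if u == p.1 then p.2 else u.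

Definition lin p : {mpoly int[n]} := 'X_p.1 - 'X_p.2.

(* The subtraction being truncated, [d < s] stands for a negative degree. *)
Definition homog_sub d s Q := if (s <= d)%N then Q \is (d - s).-homog else Q == 0.

Lemma sub_homog (f : 'I_n -> 'I_n) d P : P \is d.-homog -> sub f P \is d.-homog.
Proof.
move=> /dhomogP hP; rewrite [P]mpolyE raddf_sum big_seq.
apply: rpred_sum => m hm /=; rewrite /sub -mul_mpolyC rmorphM /= mmapC mul_mpolyC.
rewrite -/(sub f _) subXm rpredZ // -(hP m hm) /= mdegE.
elim/big_rec2: _ => [|i k Q _ hQ]; first exact: dhomog1.
by apply: dhomogM => //; rewrite mpolyXn dhomogX /= mdegMn mdeg1 mul1n.
Qed.

Lemma lin_homog p : lin p \is 1.-homog.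
Proof. by rewrite rpredB // dhomogX /= mdeg1. Qed.

Lemma prod_lin_homog (ps : seq ('I_n * 'I_n)) :
  \prod_(p <- ps) lin p \is (size ps).-homog.
Proof.
elim: ps => [|p ps IH]; first by rewrite big_nil dhomog1.
by rewrite big_cons /= -add1n; apply: dhomogM => //; apply: lin_homog.
Qed.

(** The difference of the k-th powers of two variables is divisible by the difference of the
    variables, with an explicit quotient; the other variables are carried along. *)
Lemma sub_fuse_divX p m : exists2 Q,
  'X_[m] - sub (fuse p) 'X_[m] = lin p * Q & homog_sub (mdeg m) 1 Q.
Proof.
case: p => a b; set rest := \prod_(i < n | i != a) 'X_i ^+ m i : {mpoly int[n]}.
have -> : 'X_[m] = 'X_a ^+ m a * rest by rewrite mpolyXE_id (bigD1 a).
have -> : sub (fuse (a, b)) ('X_a ^+ m a * rest) = 'X_b ^+ m a * rest.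
  rewrite rmorphM rmorphXn /= subX /fuse /= eqxx; congr (_ * _).
  rewrite rmorph_prod; apply: eq_bigr => i ia.
  by rewrite rmorphXn /= subX (negbTE ia).
exists ((\sum_(i < m a) 'X_a ^+ ((m a).-1 - i) * 'X_b ^+ i) * rest).
  by rewrite -mulrBl subrXX mulrA.
rewrite /homog_sub mdegE (bigD1 a) //=.
(* For exponent 0 the quotient is an empty sum, hence 0, which is admissible in every degree, even a
   negative one. *)
case E : (m a) => [|k]; first by rewrite big_ord0 mul0r; case: ifP; rewrite ?rpred0.
have hX (i : 'I_n) e : ('X_i : {mpoly int[n]}) ^+ e \is e.-homog.
  by rewrite mpolyXn dhomogX /= mdegMn mdeg1 mul1n.
rewrite addSn /= subSS subn0; apply: dhomogM.
  apply: rpred_sum => i _ /=.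
  by have := dhomogM (hX a (k - i)%N) (hX b i); rewrite subnK // -ltnS.
rewrite /rest; elim/big_rec2: _ => [|i e Q _ hQ]; first exact: dhomog1.
exact: dhomogM.
Qed.

Lemma sub_fuse_div p P d : P \is d.-homog -> exists2 Q,
  P - sub (fuse p) P = lin p * Q & homog_sub d 1 Q.
Proof.
move=> /dhomogP hP; rewrite [P]mpolyE big_seq.
pose G (P : {mpoly int[n]}) := exists2 Q,
  P - sub (fuse p) P = lin p * Q & homog_sub d 1 Q.
rewrite -/(G _); elim/big_ind: _ => [|P1 P2 [Q1 e1 h1] [Q2 e2 h2]|m hm].
- exists 0; first by rewrite raddf0 subrr mulr0.
  by rewrite /homog_sub; case: ifP; rewrite ?rpred0.
- exists (Q1 + Q2); first by rewrite mulrDr -e1 -e2 raddfD /=; ring.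
  move: h1 h2; rewrite /homog_sub; case: ifP => _; first exact: rpredD.
  by move=> /eqP -> /eqP ->; rewrite addr0.
- have [Q e h] := sub_fuse_divX p m; exists (P@_m *: Q).
    rewrite -scalerAr -e scalerBr; congr (_ - _).
    by rewrite -!mul_mpolyC rmorphM /= /sub mmapC.
  move: h; rewrite (hP m hm) /homog_sub; case: ifP => _; first exact: rpredZ.
  by move=> /eqP ->; rewrite scaler0.
Qed.

Lemma sub_fuse_lin p q : fuse p q.1 != fuse p q.2 -> sub (fuse p) (lin q) != 0.
Proof.
move=> h; rewrite raddfB /= !subX subr_eq0; apply: contraNneq h => e.
have /= := congr1 (fun P => P@_(U_(fuse p q.1)%MM)) e.
by rewrite !mcoeffXU eqxx eq_sym; case: (_ == _).
Qed.

(** Once the product over the rest of the list is divided out, the substitution for [p] kills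
    product times quotient, but none of the linear factors, by the pairwise condition. In an
    integral domain it then kills the quotient, which is thus divisible by [lin p]. *)
Lemma prod_lin_div (ps : seq ('I_n * 'I_n)) P d :
  P \is d.-homog -> {in ps, forall p, sub (fuse p) P = 0} ->
  pairwise (fun p q => fuse p q.1 != fuse p q.2) ps ->
  exists2 Q, P = (\prod_(p <- ps) lin p) * Q & homog_sub d (size ps) Q.
Proof.
move=> hP; elim: ps => [|p ps IH] /= h0.
  by exists P; rewrite ?big_nil ?mul1r // /homog_sub subn0.
move=> /andP[/allP pps pw]; have [|//|Q eQ hQ] := IH _ _.
  by move=> q qs; apply: h0; rewrite inE qs orbT.
have Q0 : sub (fuse p) Q = 0.
  have /eqP := h0 p (mem_head _ _); rewrite eQ rmorphM mulf_eq0 => /orP[|/eqP//].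
  rewrite rmorph_prod /= prodf_seq_eq0 => /hasP[q qs] /=.
  by rewrite (negbTE (sub_fuse_lin (pps q qs))).
case: (leqP (size ps) d) => [le|gt]; last first.
  exists 0; last by rewrite /homog_sub /= ltnNge (ltnW gt) eqxx.
  by move: hQ; rewrite eQ mulr0 /homog_sub leqNgt gt => /eqP ->; rewrite mulr0.
move: hQ; rewrite /homog_sub le => hQ.
have [Q' e' h'] := sub_fuse_div p hQ; exists Q'.
  by rewrite big_cons eQ -[Q]subr0 -[in LHS]Q0 e'; ring.
by move: h'; rewrite /homog_sub subn_gt0 -subnDA addn1.
Qed.
End Division.

(** * Counting monomials *)

(** Bounding each exponent by [d] loses nothing and makes the exponent vectors of total degree [d] a
    finite set. *)
Definition monos (n d : nat) : {set {ffun 'I_n -> 'I_d.+1}} :=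
  [set k : {ffun 'I_n -> 'I_d.+1} | (\sum_i k i)%N == d].

Section Series.
Variable R : comNzRingType.
Implicit Types f : fps R.

Lemma fcoef_exp_trunc f n k l : (l <= k)%N ->
  fcoef (f ^+ n) l = (fps_trunc k f ^+ n)`_l.
Proof.
elim: n l => [|n IH] l lk; first by rewrite !expr0 coef1.
rewrite !exprS fcoefM coefM; apply: eq_bigr => i _.
have il : (i <= k)%N by apply: leq_trans lk; rewrite -ltnS.
by rewrite coef_poly ltnS il IH // (leq_trans (leq_subr _ _)).
Qed.

Definition fps_geo : fps R := Fps (fun=> 1).

(** Coefficients up to [d] only see the truncation. Expanding the power of that finite sum gives one
    term for each choice of an exponent in each factor. *)
Lemma fcoef_geo_exp n d : fcoef (fps_geo ^+ n) d = #|monos n d|%:R.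
Proof.
rewrite (fcoef_exp_trunc _ _ (leqnn d)).
have -> : fps_trunc d fps_geo = \sum_(i < d.+1) 'X^i.
  by rewrite /fps_trunc poly_def; apply: eq_bigr => i _; rewrite scale1r.
rewrite -[n in _ ^+ n]card_ord -prodr_const bigA_distr_bigA /= coef_sum.
rewrite -sum1_card natr_sum [RHS]big_mkcond /=; apply: eq_bigr => k _.
rewrite prodrXr coefXn inE eq_sym.
by case: eqP.
Qed.

Lemma fcoefXnM n f k :
  fcoef (fpsX R ^+ n * f) k = if (n <= k)%N then fcoef f (k - n) else 0.
Proof.
have XE i : fcoef (fpsX R) i = if i == 1%N then 1 else 0 by rewrite /=; case: eqP.
elim: n k => [|n IH] k; first by rewrite mul1r subn0.
rewrite exprS -mulrA fcoefM; case: k => [|k]; first by rewrite big_ord1 XE mul0r.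
rewrite (bigD1 (Ordinal (isT : 1 < k.+2)%N)) // XE mul1r IH.
rewrite [nat_of_ord (Ordinal _)]/= !subSS subn0 ltnS.
rewrite big1 => [|i i1]; first by rewrite /= addr0.
by rewrite XE ifN ?mul0r.
Qed.

Lemma fcoefD f g k : fcoef (f + g) k = fcoef f k + fcoef g k.
Proof. by []. Qed.

Lemma fcoef1 k : fcoef (1 : fps R) k = (k == 0%N)%:R.
Proof. by []. Qed.

Lemma fcoef_nat m k : fcoef (m%:R : fps R) k = if k == 0%N then m%:R else 0.
Proof.
elim: m => [|m IH]; first by rewrite !mulr0n; case: ifP.
by rewrite !mulrS fcoefD IH fcoef1; case: ifP; rewrite ?addr0.
Qed.

Lemma fcoefCXM c n f k : fcoef (fpsC c ^+ n * f) k = c ^+ n * fcoef f k.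
Proof.
elim: n => [|n IH]; first by rewrite !mul1r.
by rewrite !exprS -!mulrA fcoefCM IH.
Qed.

Lemma fps_pos_geo : fps_pos R = fpsX R * fps_geo.
Proof.
apply/fpsP => k; rewrite -[fpsX R]expr1 fcoefXnM /=.
by case: (0 < k)%N.
Qed.

Lemma fps_geoE : fps_geo = 1 + fps_pos R.
Proof. by apply/fpsP => -[|k] /=; rewrite ?addr0 ?add0r. Qed.

Lemma fcoef_pos_exp n k :
  fcoef (fps_pos R ^+ n) k = if (n <= k)%N then #|monos n (k - n)|%:R else 0.
Proof. by rewrite fps_pos_geo exprMn fcoefXnM fcoef_geo_exp. Qed.
End Series.

Lemma fps_pos_div (R : comUnitRingType) :
  fps_pos R = fpsX R / (1 - fpsX R).
Proof.
have E : fps_geo R * (1 - fpsX R) = 1.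
  by rewrite mulrBr mulr1 [_ * fpsX R]mulrC -fps_pos_geo {1}fps_geoE addrK.
have U : 1 - fpsX R \is a GRing.unit.
  by apply/unitrPr; exists (fps_geo R); rewrite mulrC.
by apply: (mulIr U); rewrite divrK // {1}fps_pos_geo -mulrA E mulr1.
Qed.

(** * The ranks read off from the series *)

Section Ranks.
Implicit Types i j n : nat.

(** For [n = 2] the exceptional degree [n - 2] is 0 as well, and both summands of the series meet
    there: with p = q/(1-q), p^2 + p = p (1 + p) = q/(1-q)^2 counts monomials of degree [j - 1],
    whence the value 1 of [D]. *)
Definition H_rank n i j : nat :=
  if i == 0%N then
    let D := if n == 2%N then 1%N else n in
    if (D <= j)%N then #|monos n (j - D)| else 0%N
  else ((i == (n - 2)%N) && (0 < j)%N).

Lemma H_rank_series n i j : (2 <= n)%N ->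
  fcoef (fcoef (fps_pos (fps int) ^+ n +
     fpsC (fpsX int) ^+ (n - 2) * fps_pos (fps int)) j) i = (H_rank n i j)%:Z.
Proof.
move=> n2; rewrite /H_rank.
case: (eqVneq n 2%N) => [->|nn2].
  rewrite subnn mul1r.
  have -> : fps_pos (fps int) ^+ 2 + fps_pos (fps int) =
      fpsX (fps int) ^+ 1 * fps_geo (fps int) ^+ 2.
    have -> (p : fps (fps int)) : p ^+ 2 + p = p * (1 + p).
      by rewrite mulrDr mulr1 expr2 addrC.
    by rewrite -fps_geoE fps_pos_geo -mulrA -expr2.
  rewrite fcoefXnM fcoef_geo_exp.
  by case: leqP => _; rewrite ?fcoef_nat; case: eqVneq => _ //; rewrite ?natz ?andbF.
have n3 : (2 < n)%N by rewrite ltn_neqAle eq_sym nn2.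
have n20 : (n - 2 == 0)%N = false by rewrite subn_eq0 leqNgt n3.
rewrite !fcoefD fcoef_pos_exp fcoefCXM fcoefXnM.
have -> : fcoef (fps_pos (fps int)) j = ((0 < j)%N : nat)%:R by [].
have -> : fcoef (if (n <= j)%N then #|monos n (j - n)|%:R else 0 : fps int) i =
   if i == 0%N then if (n <= j)%N then #|monos n (j - n)|%:R else 0 else 0.
  by case: (n <= j)%N; rewrite ?fcoef_nat //; case: ifP.
rewrite fcoef_nat; case: (eqVneq i 0%N) => [->|i0].
  rewrite leqn0 n20 addr0.
  by case: ifP; rewrite ?natz.
rewrite add0r; case: (eqVneq i (n - 2)%N) => [->|ni]; first by rewrite leqnn subnn natz.
case: (leqP (n - 2) i) => // le.
have lt : (n - 2 < i)%N by rewrite ltn_neqAle eq_sym ni le.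
by rewrite subn_eq0 leqNgt lt.
Qed.
End Ranks.

(** * Monomials as a basis of the homogeneous polynomials *)

Section HomogBasis.
Variables n d : nat.

Definition monom (k : {ffun 'I_n -> 'I_d.+1}) : 'X_{1..n} :=
  [multinom (k i : nat) | i < n].

Lemma monom_inj : injective monom.
Proof.
move=> k l e; apply/ffunP => i; apply: val_inj.
by have := congr1 (fun m : 'X_{1..n} => m i) e; rewrite !mnmE.
Qed.

Lemma mdeg_monom k : k \in monos n d -> mdeg (monom k) = d.
Proof.
rewrite inE => /eqP <-; rewrite mdegE.
by apply: eq_bigr => i _; rewrite mnmE.
Qed.

Lemma monom_surj (m : 'X_{1..n}) : mdeg m = d ->
  exists2 k, k \in monos n d & monom k = m.
Proof.
move=> hm; have lt i : (m i < d.+1)%N.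
  by rewrite ltnS -hm mdegE (bigD1 i) //= leq_addr.
exists [ffun i => Ordinal (lt i)]; last first.
  by apply/mnmP => i; rewrite mnmE ffunE.
rewrite inE -[X in _ == X]hm mdegE; apply/eqP.
by apply: eq_bigr => i _; rewrite ffunE.
Qed.

Lemma homog_basis (Q : {mpoly int[n]}) : Q \is d.-homog ->
  exists! c : {ffun 'I_#|monos n d| -> int},
    Q = \sum_k c k *: 'X_[monom (enum_val k)].
Proof.
move=> hQ.
have coefE (c : {ffun 'I_#|monos n d| -> int}) k :
    (\sum_k c k *: 'X_[monom (enum_val k)])@_(monom (enum_val k)) = c k.
  rewrite raddf_sum (bigD1 k) //= mcoeffZ mcoeffX eqxx mulr1 big1 ?addr0 // => l lk.
  rewrite mcoeffZ mcoeffX (inj_eq monom_inj) (inj_eq enum_val_inj) (negbTE lk).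
  exact: mulr0.
exists [ffun k => Q@_(monom (enum_val k))]; split; last first.
  by move=> c eQ; apply/ffunP => k; rewrite ffunE {1}eQ coefE.
apply/mpolyP => m; case: (eqVneq (mdeg m) d) => [hm|nm].
  have [k hk <-] := monom_surj hm.
  by rewrite -[k](enum_rankK_in hk hk) coefE ffunE.
rewrite (dhomog_nemf_coeff hQ nm) raddf_sum big1 //= => k _.
rewrite mcoeffZ mcoeffX; case: eqP => [e|]; last by rewrite mulr0.
by rewrite -e mdeg_monom ?eqxx ?enum_valP in nm.
Qed.
End HomogBasis.

(** * The complex of the polygon *)

Section FreeCohomology.
Variables (V E : finType) (ends : E -> V * V) (le : rel E).
Variables (A : comNzRingType) (gr : nat -> A -> Prop) (i j : nat).

(** Freeness of the quotient is reduced to representatives: up to a coboundary, each cocycle must be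
    a unique integer combination of the [b k]. *)
Lemma free_of_rank_cohomology r (b : 'I_r -> graph_complex ends A) :
  (forall k, b k \in cocycle le gr i j) ->
  (forall z, z \in cocycle le gr i j -> exists! c : {ffun 'I_r -> int},
     is_coboundary le gr i j (z - \sum_k b k *~ c k)) ->
  free_of_rank (cohomology ends le gr i j) r.
Proof.
move=> bZ hb; pose b' k : Zgroup ends le gr i j := MkZ (bZ k).
exists (fun k => \pi_(cohomology ends le gr i j) (b' k)) => x.
have piE (z : Zgroup ends le gr i j) (c : {ffun 'I_r -> int}) :
    \pi_(cohomology ends le gr i j) z =
      \sum_k \pi_(cohomology ends le gr i j) (b' k) *~ c k <->
    is_coboundary le gr i j (Zval z - \sum_k b k *~ c k).
  have -> : \sum_k \pi_(cohomology ends le gr i j) (b' k) *~ c k =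
      \pi_(cohomology ends le gr i j) (\sum_k b' k *~ c k).
    by rewrite raddf_sum; apply: eq_bigr => k _; rewrite raddfMz.
  have -> : Zval z - \sum_k b k *~ c k = Zval (z - \sum_k b' k *~ c k).
    rewrite [RHS](raddfB val) (raddf_sum val) /=; congr (_ - _).
    by apply: eq_bigr => k _; rewrite [RHS](raddfMz val).
  split=> [/eqP|h]; first by rewrite -Quotient.idealrBE => /asboolP.
  by apply/eqP; rewrite -Quotient.idealrBE; apply/asboolP.
rewrite -[x]reprK; move: (repr x) => {x} z.
have [|c [hc uc]] := hb (Zval z); first exact: (valP z).
by exists c; split=> [|c']; rewrite piE //; apply: uc.
Qed.
End FreeCohomology.

(** * Arcs of the polygon and normal forms of classes *)

Section Polygon.
Variable m : nat.
Local Notation n := m.+2.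
Local Notation ends := (@polygon n).
Local Notation Phi s := (Phi ends {poly int} s).
Implicit Types (s : {set 'I_n}) (u v e f r : 'I_n) (P : {mpoly int[n]}).

(** Edge [v] starts at vertex [v], so this moves forward along an arc and stands still at its end.
    Unless [s] contains all edges, [n] moves suffice to get there. *)
Definition step s v : 'I_n := if v \in s then ordS v else v.

(* The last vertex of the arc of [u], that is, the first vertex [v] after [u]
   (cyclically) such that the edge from [v] to [v + 1] is not in [s]. *)
Definition arc_end s u : 'I_n := if s == setT then ord0 else iter n (step s) u.

Lemma val_iter_ordS k u : val (iter k (@ordS n) u) = ((u + k) %% n)%N.
Proof.
elim: k => [|k IH]; first by rewrite addn0 modn_small.
by rewrite iterS [LHS]/= IH addnS -addn1 modnDml addn1.
Qed.

Lemma reach_ordS u v : exists2 k, (k < n)%N & iter k (@ordS n) u = v.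
Proof.
exists ((v + (n - u)) %% n)%N; first by rewrite ltn_mod.
apply: val_inj; rewrite val_iter_ordS modnDmr addnCA subnKC ?(ltnW (ltn_ord u)) //.
by rewrite modnDr modn_small.
Qed.

Lemma iter_step_out s u k : u \notin s -> iter k (step s) u = u.
Proof. by move=> us; elim: k => //= k ->; rewrite /step (negbTE us). Qed.

(** If it did not stop, the walk would meet any given vertex outside [s] in fewer than [n] moves;
    once outside [s], it stays. *)
Lemma arc_end_notin s u : s != setT -> arc_end s u \notin s.
Proof.
move=> sT; rewrite /arc_end (negbTE sT).
have [v vs] : exists v, v \notin s.
  apply/existsP; apply: contraNT sT; rewrite negb_exists => /forallP h.
  by apply/eqP/setP => v; rewrite inE; apply/negPn.
have [k kn kv] := reach_ordS u v.
have -> : iter n (step s) u = iter (n - k) (step s) (iter k (step s) u).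
  by rewrite -iterD subnK // ltnW.
suff h : iter k (step s) u \notin s by rewrite iter_step_out.
rewrite -{v}kv in vs; elim: k u vs {kn} => [|k IH] u vs //.
case: (boolP (u \in s)) => us; last by rewrite iter_step_out.
by rewrite iterSr {2}/step us; apply: IH; rewrite -iterSr.
Qed.

Lemma arc_end_out s u : u \notin s -> arc_end s u = u.
Proof.
move=> us; rewrite /arc_end ifN ?iter_step_out //.
by apply: contraNneq us => ->; rewrite inE.
Qed.

(** Starting one vertex later means making one more move, and after [n] moves the walk stands still
    already. *)
Lemma arc_end_ordS s u : u \in s -> arc_end s (ordS u) = arc_end s u.
Proof.
move=> us; rewrite /arc_end; case: eqP => // /eqP sT.
have -> : ordS u = step s u by rewrite /step us.
rewrite -iterSr iterS; have := arc_end_notin u sT.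
by rewrite /arc_end (negbTE sT) {2}/step => /negbTE ->.
Qed.

Lemma connect_ordS s u : u \in s -> connect (adj ends s) u (ordS u).
Proof.
by move=> us; apply: connect1; apply/existsP; exists u; rewrite us eqxx.
Qed.

Lemma connect_arc_end s u : connect (adj ends s) u (arc_end s u).
Proof.
rewrite /arc_end; case: eqP => [->|_].
  have [k _ <-] := reach_ordS u ord0.
  elim: k u => [|k IH] u //; rewrite iterSr; apply: connect_trans (IH _).
  by apply: connect_ordS; rewrite inE.
suff h k : connect (adj ends s) u (iter k (step s) u) by exact: h.
elim: k u => [|k IH] u //; rewrite iterSr; apply: connect_trans (IH _).
by rewrite /step; case: ifP => // us; apply: connect_ordS.
Qed.

Lemma eq_arc_end s u v : connect (adj ends s) u v -> arc_end s u = arc_end s v.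
Proof.
move=> /connectP[p]; elim: p u => [|w p IH] u /=; first by move=> _ ->.
case/andP=> uw pw ev; rewrite -(IH w pw ev).
case/existsP: uw => e /andP[es]; rewrite /polygon.
by case/orP => /eqP[<- <-]; rewrite arc_end_ordS.
Qed.

(* [Phi s] is the quotient of the polynomial ring that identifies the variables
   of each arc; [plift] writes a class in the variables of the arc ends. *)
Definition pclass s P : Phi s := tens_map (comp_of ends s) (theta P).
Definition plift s (z : Phi s) : {mpoly int[n]} :=
  psi (tens_map (fun c : Defs.comp ends s => arc_end s (val c)) z).

Lemma pclassB s : {morph @pclass s : P Q / P - Q}.
Proof. by move=> P Q; rewrite /pclass !raddfB. Qed.
HB.instance Definition _ s :=
  GRing.isZmodMorphism.Build {mpoly int[n]} (Phi s) (@pclass s) (@pclassB s).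

Lemma pliftB s : {morph @plift s : x y / x - y}.
Proof. by move=> x y; rewrite /plift !raddfB. Qed.
HB.instance Definition _ s :=
  GRing.isZmodMorphism.Build (Phi s) {mpoly int[n]} (@plift s) (@pliftB s).

Lemma pclass0 s : pclass s 0 = 0. Proof. exact: raddf0. Qed.
Lemma plift0 s : plift (0 : Phi s) = 0. Proof. exact: raddf0. Qed.

Lemma pliftK s (z : Phi s) : pclass s (plift z) = z.
Proof.
rewrite /pclass /plift psiK tens_map_comp tens_map_id // => c /=; apply: val_inj => /=.
rewrite -[RHS](eqP (valP c)); apply/eqP.
rewrite root_connect; last exact: adj_connect_sym.
by rewrite adj_connect_sym connect_arc_end.
Qed.

(** Together with [pliftK], this identifies [Phi s] with the polynomials fixed by the substitution
    of arc ends. *)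
Lemma pclassK s P : plift (pclass s P) = sub (arc_end s) P.
Proof.
rewrite /plift /pclass tens_map_comp psi_map_theta; apply: eq_sub => u /=.
apply: eq_arc_end; rewrite adj_connect_sym; exact: connect_root.
Qed.

Lemma sub_plift s (z : Phi s) : sub (arc_end s) (plift z) = plift z.
Proof. by rewrite -pclassK pliftK. Qed.

Lemma Phi_map_pclass s s' P : s \subset s' ->
  Phi_map (ends := ends) s' (pclass s P) = pclass s' P.
Proof.
move=> ss'; rewrite /Phi_map /pclass tens_map_comp; apply: eq_tens_map => u.
by apply: val_inj => /=; rewrite root_adj_sub.
Qed.

Lemma pclass_deg s j P : P \is j.-homog -> tens_deg deg_Zx j (pclass s P).
Proof. by move=> hP; apply: tens_map_deg; apply: theta_deg. Qed.

Lemma plift_deg s j (z : Phi s) : tens_deg deg_Zx j z -> plift z \is j.-homog.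
Proof. by move=> hz; apply: psi_deg; apply: tens_map_deg. Qed.

End Polygon.

(** * Cochains as families of polynomials *)

Section Cochains.
Variables (m : nat) (le : rel 'I_m.+2).
Local Notation n := m.+2.
Implicit Types (s : {set 'I_n}) (u v e f g r : 'I_n) (P : {mpoly int[n]}).
Implicit Types (x y w : {ffun {set 'I_n} -> {mpoly int[n]}}) (i j k : nat).

Lemma arc_end_sub s s' u : s \subset s' -> arc_end s' (arc_end s u) = arc_end s' u.
Proof.
move=> ss'; apply: eq_arc_end; rewrite adj_connect_sym.
apply: connect_sub (connect_arc_end s u) => v w /existsP[e /andP[es h]].
by apply: connect1; apply/existsP; exists e; rewrite (subsetP ss').
Qed.

Lemma sub_arc_end s s' P : s \subset s' ->
  sub (arc_end s') (sub (arc_end s) P) = sub (arc_end s') P.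
Proof. by move=> ss'; rewrite sub_comp; apply: eq_sub => u /=; rewrite arc_end_sub. Qed.

Definition edge_sign s e : int := (-1) ^+ sgn_exp le (s :\ e) e.

Lemma edge_signK s e P : P *~ edge_sign s e *~ edge_sign s e = P.
Proof. by rewrite -mulrzA -expr2 sqrr_sign. Qed.

(** The differential transported along [plift]: the substitution brings the value at [s :\ e] into
    the normal form for [s]. *)
Definition pdiff x : {ffun {set 'I_n} -> {mpoly int[n]}} :=
  [ffun s : {set 'I_n} => \sum_(e in s) sub (arc_end s) (x (s :\ e)) *~ edge_sign s e].

Lemma pdiffE x s :
  pdiff x s = \sum_(e in s) sub (arc_end s) (x (s :\ e)) *~ edge_sign s e.
Proof. by rewrite ffunE. Qed.

Lemma pdiffB : {morph pdiff : x y / x - y}.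
Proof.
move=> x y; apply/ffunP => s; rewrite !ffunE -sumrB.
by apply: eq_bigr => e _; rewrite !ffunE raddfB mulrzBl.
Qed.
HB.instance Definition _ := GRing.isZmodMorphism.Build
  {ffun {set 'I_n} -> {mpoly int[n]}} {ffun {set 'I_n} -> {mpoly int[n]}} pdiff pdiffB.

Definition normal x := forall s, sub (arc_end s) (x s) = x s.

Definition pchain i j x :=
  normal x /\ forall s, if #|s| == i then is_true (x s \is j.-homog) else x s = 0.

Lemma pchainB i j x y : pchain i j x -> pchain i j y -> pchain i j (x - y).
Proof.
move=> [nx hx] [ny hy]; split=> s; first by rewrite !ffunE raddfB /= nx ny.
move: (hx s) (hy s); rewrite !ffunE; case: ifP => _; first exact: rpredB.
by move=> -> ->; rewrite subr0.
Qed.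

Lemma pchain0 i j : pchain i j 0.
Proof.
split=> s; rewrite ffunE ?raddf0 //; case: ifP => // _; exact: rpred0.
Qed.

Lemma pchain_diff i j x : pchain i j x -> pchain i.+1 j (pdiff x).
Proof.
move=> [nx hx]; split=> s.
  rewrite pdiffE raddf_sum /=; apply: eq_bigr => e _.
  by rewrite raddfMz /= sub_arc_end.
have card e : e \in s -> (#|s :\ e| == i) = (#|s| == i.+1).
  by move=> es; rewrite (cardsD1 e s) es.
case: ifP => hs; rewrite pdiffE.
  apply: rpred_sum => e es; rewrite -scaler_int rpredZ // sub_homog //.
  by have := hx (s :\ e); rewrite card // hs.
apply: big1 => e es; have := hx (s :\ e); rewrite card // hs => ->.
by rewrite raddf0 mul0rz.
Qed.

Definition tail_set k : {set 'I_n} := [set v : 'I_n | n - k <= v]%N.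

Definition supp_above k x := forall s, ~~ (tail_set k \subset s) -> x s = 0.

Lemma supp_above_diff k x : supp_above k x -> supp_above k (pdiff x).
Proof.
move=> hx s hs; rewrite pdiffE; apply: big1 => e es; rewrite hx ?raddf0 ?mul0rz //.
by apply: contraNN hs => h; apply: subset_trans h (subD1set _ _).
Qed.

Lemma supp_aboveB k x y : supp_above k x -> supp_above k y -> supp_above k (x - y).
Proof. by move=> hx hy s hs; rewrite !ffunE hx // hy // subr0. Qed.

(** The walk from [f] stops at [r] at the latest, so it stays between [f] and [r] and never meets
    [e]. *)
Lemma arc_end_U1 s e f r : r \notin s -> (e < f <= r)%N ->
  arc_end (e |: s) f = arc_end s f.
Proof.
move=> rs /andP[ef fr].
have re : r != e by apply: contraTneq (leq_trans ef fr) => ->; rewrite ltnn.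
have res : r \notin e |: s by rewrite !inE negb_or re.
have nT (t : {set 'I_n}) : r \notin t -> t != setT.
  by apply: contraNneq => ->; rewrite inE.
rewrite /arc_end !ifN ?nT //.
suff h k : iter k (step (e |: s)) f = iter k (step s) f /\
    (f <= iter k (step s) f <= r)%N by case: (h n).
elim: k => [|k [IH /andP[h1 h2]]]; first by rewrite leqnn fr.
rewrite !iterS IH; set x := iter k _ f in h1 h2 *.
have xe : x != e by apply: contraTneq (leq_trans ef h1) => ->; rewrite ltnn.
rewrite /step !inE (negbTE xe); case: ifP => xs; last by rewrite h1 h2.
have xr : (x < r)%N.
  by rewrite ltn_neqAle h2 andbT; apply: contraNneq rs => /val_inj <-.
split=> //; rewrite /= modn_small; first by rewrite xr (leq_trans h1).
exact: leq_ltn_trans xr (ltn_ord r).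
Qed.

(* Re-inserting the edge [e] as a variable of exponent 0 is a homotopy that
   commutes with the merges of the edges [f] with [e < f < r]. *)
Lemma clear_edge k r e i j y : (e < r)%N -> (r < n - k)%N ->
  pchain i.+1 j y -> supp_above k y ->
  (forall s, r \notin s -> pdiff y s = 0) ->
  (forall s f, r \notin s -> f \in s -> (e < f < r)%N -> y s = 0) ->
  exists w, [/\ pchain i j w, supp_above k w &
    forall s f, r \notin s -> f \in s -> (e <= f < r)%N -> (y - pdiff w) s = 0].
Proof.
move=> er rk [ny hy] Ly dy0 y0.
have ne : r != e by apply: contraTneq er => ->; rewrite ltnn.
pose w := [ffun s : {set 'I_n} => if (e \notin s) && (r \notin s) then
  sub (arc_end s) (y (e |: s)) *~ edge_sign (e |: s) e else 0].
exists w; split=> [|s hs|s f rs fs /andP[ef fr]].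
- split=> s; rewrite ffunE; case: (boolP ((e \notin s) && _)) => [/andP[es _]|_].
  + by rewrite raddfMz /= sub_arc_end.
  + exact: raddf0.
  + have := hy (e |: s); rewrite cardsU1 es add1n eqSS; case: ifP => _ h.
      by rewrite -scaler_int rpredZ // sub_homog.
    by rewrite h raddf0 mul0rz.
  + by case: ifP => // _; apply: rpred0.
- rewrite ffunE; case: ifP => // _; rewrite Ly ?raddf0 ?mul0rz //.
  apply: contraNN hs => /subsetP h; apply/subsetP => v vT.
  have := h v vT; rewrite !inE => /orP[/eqP ve|//].
  by move: vT; rewrite ve inE leqNgt (ltn_trans er).
rewrite [LHS]ffunE [X in _ + X]ffunE; apply/eqP; rewrite subr_eq0; apply/eqP.
(* If [e] is in [s], only the term of [e] remains in the differential of [w]; its two signs cancel,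
   which gives back [y s]. *)
rewrite pdiffE; case: (boolP (e \in s)) => es.
  rewrite (bigD1 e) //= [X in _ + X]big1 ?addr0 => [|g /andP[gs ge]]; last first.
    by rewrite ffunE !inE eq_sym ge es raddf0 mul0rz.
  rewrite ffunE !inE eqxx (negbTE rs) andbF /= setD1K // raddfMz /= edge_signK.
  by rewrite sub_arc_end ?subD1set.
(* If [e] is not in [s], then [y s] is 0 and the differential of [w] has to vanish at [s]. Every
   term but that of [f] involves a value of [y] at a set that contains [f] and not [r]. *)
have {}ef : (e < f)%N.
  by rewrite ltn_neqAle ef andbT; apply: contraNneq es => /val_inj ->.
rewrite (y0 s f) ?ef ?fr //; apply/esym; apply: big1 => g gs.
have res : r \notin e |: s by rewrite !inE negb_or ne.
have yf (t : {set 'I_n}) : r \notin t -> f \in t -> y t = 0.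
  by move=> rt ft; apply: (y0 t f); rewrite ?ef.
have fe : f != e by apply: contraTneq ef => ->; rewrite ltnn.
rewrite ffunE; case: ifP => _; last by rewrite raddf0 mul0rz.
case: (eqVneq g f) => [->|gf]; last first.
  rewrite yf ?raddf0 ?mul0rz ?raddf0 ?mul0rz // !inE ?negb_or ?negb_and ?ne ?rs ?orbT //.
  by rewrite (eq_sym f g) gf fs orbT.
have -> : e |: s :\ f = (e |: s) :\ f.
  by apply/setP => v; rewrite !inE; case: (eqVneq v e) => [->|] //=; rewrite eq_sym fe.
set t := (e |: s) :\ f.
(* In the cocycle condition at [e |: s], only the term of [f] is left. *)
have y0' : sub (arc_end (e |: s)) (y t) = 0.
  have := dy0 _ res; rewrite pdiffE (bigD1 f) /=; last by rewrite !inE fs orbT.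
  rewrite big1 ?addr0 => [|h /andP[_ hf]].
    move=> h; have := congr1 (fun z => z *~ edge_sign (e |: s) f) h.
    by rewrite edge_signK mul0rz.
  rewrite yf ?raddf0 ?mul0rz // !inE ?negb_and ?negb_or ?rs ?ne ?orbT //.
  by rewrite (eq_sym f h) hf fs orbT.
rewrite raddfMz /= sub_arc_end ?subD1set //.
suff -> : sub (arc_end s) (y t) = 0 by rewrite !mul0rz.
(* It remains to replace [e |: s] by [s] in the substitution. As [y t] is normal, only arc ends of
   [t] matter, and these have the same arc end in [s] as in [e |: s]. *)
rewrite -ny sub_comp; rewrite -ny sub_comp in y0'.
rewrite -[RHS]y0'; apply: eq_sub => v /=; set a := arc_end t v.
have aT : a \notin t.
  apply: arc_end_notin; apply: contraNneq res => tT.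
  have rt : r \in t by rewrite tT inE.
  by move: rt; rewrite /t in_setD1 => /andP[].
case: (eqVneq a f) => [->|af]; first by rewrite (arc_end_U1 (r := r)) // ef ltnW.
have aes : a \notin e |: s by move: aT; rewrite !inE af.
rewrite (arc_end_out aes) arc_end_out //.
by apply: contraNN aes => h; rewrite inE h orbT.
Qed.
End Cochains.

(** * Moving cochains to a tail of edges *)

Section Reduction.
Variables (m : nat) (le : rel 'I_m.+2).
Hypotheses (le_anti : antisymmetric le) (le_total : total le).
Local Notation n := m.+2.
Local Notation ends := (@polygon n).
Local Notation Phi s := (Phi ends {poly int} s).
Local Notation C := (graph_complex ends {poly int}).
Implicit Types (s : {set 'I_n}) (u v e f g r : 'I_n) (P : {mpoly int[n]}).
Implicit Types (x y w : {ffun {set 'I_n} -> {mpoly int[n]}}) (i j k : nat).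

Definition plift_fam (z : C) : {ffun {set 'I_n} -> {mpoly int[n]}} :=
  [ffun s : {set 'I_n} => plift (z s)].

Definition pclass_fam x : C := [ffun s => (pclass s (x s) : Phi s)].

Lemma plift_famB : {morph plift_fam : z1 z2 / z1 - z2}.
Proof.
move=> z1 z2; apply/ffunP => s; by rewrite ffunE (dsumBE z1 z2 s) pliftB !ffunE.
Qed.
HB.instance Definition _ :=
  GRing.isZmodMorphism.Build C {ffun {set 'I_n} -> {mpoly int[n]}} plift_fam plift_famB.

Lemma plift_famK z : pclass_fam (plift_fam z) = z.
Proof. by apply/ffunP => s; rewrite ffunE ffunE pliftK. Qed.

Lemma plift_fam_inj : injective plift_fam.
Proof. exact: can_inj plift_famK. Qed.

Lemma pclass_famK x : normal x -> plift_fam (pclass_fam x) = x.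
Proof. by move=> nx; apply/ffunP => s; rewrite ffunE ffunE pclassK nx. Qed.

Lemma plift_fam_diff z : plift_fam (graph_diff le z) = pdiff le (plift_fam z).
Proof.
apply/ffunP => s; rewrite ffunE ffunE pdiffE raddf_sum /=; apply: eq_bigr => e es.
rewrite raddfMz /= -{1}[z (s :\ e)]pliftK Phi_map_pclass ?subD1set // pclassK.
by rewrite ffunE.
Qed.

Lemma plift_fam_chain i j z : in_chain deg_Zx i j z <-> pchain i j (plift_fam z).
Proof.
split=> [hz|[nz hz] s].
  split=> s; rewrite ffunE; first exact: sub_plift.
  have := hz s; case: ifP => _; first exact: plift_deg.
  by move=> ->; apply: plift0.
have := hz s; rewrite ffunE; case: ifP => _ h.
  by rewrite -[z s]pliftK; apply: pclass_deg.
by rewrite -[LHS]pliftK h pclass0.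
Qed.

Lemma pdiffK i j x : pchain i j x -> pdiff le (pdiff le x) = 0.
Proof.
move=> [nx _]; rewrite -(pclass_famK nx) -!plift_fam_diff graph_diffK //.
exact: raddf0.
Qed.

Lemma pchainD i j x y : pchain i j x -> pchain i j y -> pchain i j (x + y).
Proof.
move=> hx hy; rewrite -[y]opprK; apply: pchainB => //.
by rewrite -sub0r; apply: pchainB => //; apply: pchain0.
Qed.

(** Edges are cleared downwards from [r - 1], since clearing [e] presupposes that the edges between
    [e] and [r] are cleared. The corrections add up. *)
Lemma clear_edges k r i j y c : (c <= r)%N -> (r < n - k)%N ->
  pchain i.+1 j y -> supp_above k y ->
  (forall s, r \notin s -> pdiff le y s = 0) ->
  exists w, [/\ pchain i j w, supp_above k w &
    forall s f, r \notin s -> f \in s -> (r - c <= f < r)%N ->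
      (y - pdiff le w) s = 0].
Proof.
move=> cr rk hy Ly dy; elim: c cr => [|c IH] cr.
  exists 0; split=> [|s _|s f _ _]; first exact: pchain0; first by rewrite ffunE.
  by rewrite subn0 => /andP[h1 h2]; have := leq_ltn_trans h1 h2; rewrite ltnn.
have [w [hw Lw yw]] := IH (ltnW cr).
have en : (r - c.+1 < n)%N by apply: leq_ltn_trans (leq_subr _ _) (ltn_ord r).
have er : (Ordinal en < r)%N by rewrite /= ltn_subrL (leq_ltn_trans _ cr).
have Ec : (Ordinal en).+1 = (r - c)%N by rewrite /= subnSK.
have [||s rs|s f rs fs|w' [hw' Lw' yw']] :=
    @clear_edge _ le k r (Ordinal en) i j (y - pdiff le w) er rk.
- by apply: pchainB => //; apply: pchain_diff.
- by apply: supp_aboveB => //; apply: supp_above_diff.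
- by rewrite raddfB /= (pdiffK hw) subr0 dy.
- by rewrite Ec; apply: yw.
exists (w + w'); split; first exact: pchainD.
  by move=> s hs; rewrite ffunE Lw // Lw' // addr0.
by move=> s f rs fs h; rewrite raddfD opprD addrA; apply: yw' h.
Qed.

Lemma tail_setS k r : (r = n - k.+1 :> nat)%N -> (k < n)%N ->
  tail_set m k.+1 = r |: tail_set m k.
Proof.
move=> rE kn; apply/setP => v; rewrite !inE -val_eqE /= rE.
by rewrite leq_eqVlt eq_sym subnSK.
Qed.

Lemma card_tail_set k : (k <= n)%N -> #|tail_set m k| = k.
Proof.
elim: k => [_|k IH kn].
  by apply: eq_card0 => v; rewrite inE subn0 leqNgt ltn_ord.
have rn : (n - k.+1 < n)%N by rewrite ltn_subrL.
rewrite (@tail_setS k (Ordinal rn)) // cardsU1 IH ?(ltnW kn) // inE /=.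
by rewrite -ltnNge ltn_sub2lE // ltnSn.
Qed.

(** With r = n-k-1, all edges below [r] are cleared. A set of [i.+1 > k] edges that contains the
    tail of [k] edges but not [r] must contain an edge below [r], so the value there is 0. *)
Lemma reduce_tail k i j y : (k < n)%N -> (k <= i)%N ->
  pchain i.+1 j y -> supp_above k y ->
  (forall s, ~~ (tail_set m k.+1 \subset s) -> pdiff le y s = 0) ->
  exists2 w, pchain i j w & supp_above k.+1 (y - pdiff le w).
Proof.
move=> kn ki hy Ly dy; have rn : (n - k.+1 < n)%N by rewrite ltn_subrL.
pose r := Ordinal rn; have rT : tail_set m k.+1 = r |: tail_set m k.
  exact: tail_setS.
have rk : (r < n - k)%N by rewrite /= subnSK.
have [|w [hw Lw yw]] := @clear_edges k r i j y r (leqnn _) rk hy Ly.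
  by move=> s rs; apply: dy; apply: contraNN rs; rewrite rT subUset sub1set => /andP[].
exists w => // s; rewrite rT subUset sub1set negb_and => /orP[rs|]; last first.
  by apply: supp_aboveB => //; apply: supp_above_diff.
case: (boolP (tail_set m k \subset s)) => [Ts|]; last first.
  by apply: supp_aboveB => //; apply: supp_above_diff.
have [_ /(_ s)] := pchainB hy (pchain_diff le hw).
case: eqP => // cs _.
have /subsetPn[f fs fT] : ~~ (s \subset tail_set m k).
  apply: contraTN ki => /subset_leq_card; rewrite cs card_tail_set ?(ltnW kn) //.
  by rewrite ltnNge.
apply: (yw s f) => //; rewrite subnn /=.
move: fT; rewrite inE -ltnNge => fk.
rewrite ltn_neqAle -ltnS subnSK // fk andbT.
by apply: contraNneq rs => fr; rewrite (_ : r = f) //; apply: val_inj.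
Qed.

(** The hypothesis on [pdiff le y] is weaker than being a cocycle: in the exceptional degree, the
    lemma is applied to a cochain with a prescribed coboundary at a tail. *)
Lemma reduce_chain i j y k : (i < n)%N -> (k <= i.+1)%N ->
  pchain i.+1 j y ->
  (forall s, ~~ (tail_set m i.+1 \subset s) -> pdiff le y s = 0) ->
  exists2 w, pchain i j w & supp_above k (y - pdiff le w).
Proof.
move=> iN + hy dy; elim: k => [_|k IH ki].
  exists 0; first exact: pchain0.
  move=> s /negP[]; apply/subsetP => v.
  by rewrite inE subn0 leqNgt ltn_ord.
have [w hw Lw] := IH (ltnW ki).
have [|//||s hs|w' hw' Lw'] := @reduce_tail k i j (y - pdiff le w) _ _ _ Lw.
- exact: leq_trans ki iN.
- by apply: pchainB => //; apply: pchain_diff.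
- rewrite raddfB /= (pdiffK hw) subr0 dy //; apply: contraNN hs => h.
  apply: subset_trans h; apply/subsetP => v; rewrite !inE; apply: leq_trans.
  by rewrite leq_sub2l.
exists (w + w'); first exact: pchainD.
by rewrite raddfD opprD addrA.
Qed.

Lemma supp_above_single i j x s : (i <= n)%N -> pchain i j x -> supp_above i x ->
  s != tail_set m i -> x s = 0.
Proof.
move=> iN [_ hx] Lx; case: (boolP (tail_set m i \subset s)) => [Ts|/Lx //] sT.
have := hx s; case: eqP => // cs _; case/negP: sT.
by rewrite eq_sym eqEcard Ts cs card_tail_set // leqnn.
Qed.
End Reduction.

(** * Cocycles supported at a tail of edges *)

Section TailPolynomials.
Variables (m : nat) (le : rel 'I_m.+2).
Local Notation n := m.+2.
Local Notation T := (tail_set m).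
Implicit Types (s : {set 'I_n}) (u v e f g : 'I_n) (P Q F : {mpoly int[n]}).
Implicit Types (x y w : {ffun {set 'I_n} -> {mpoly int[n]}}) (i j k r : nat).

Definition single s P : {ffun {set 'I_n} -> {mpoly int[n]}} :=
  [ffun t : {set 'I_n} => if t == s then sub (arc_end s) P else 0].

Lemma singleB s : {morph single s : P Q / P - Q}.
Proof.
move=> P Q; apply/ffunP => t; rewrite !ffunE raddfB /=.
by case: ifP => _ //; rewrite subr0.
Qed.
HB.instance Definition _ s := GRing.isZmodMorphism.Build
  {mpoly int[n]} {ffun {set 'I_n} -> {mpoly int[n]}} (single s) (singleB s).

Lemma single_chain j s P : P \is j.-homog -> pchain #|s| j (single s P).
Proof.
move=> hP; split=> t; rewrite ffunE.
  by case: eqP => [->|_]; rewrite ?sub_arc_end // raddf0.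
case: (eqVneq t s) => [->|ts]; first by rewrite eqxx; apply: sub_homog.
by case: ifP => // _; apply: rpred0.
Qed.

Lemma eq_single s P Q : sub (arc_end s) P = sub (arc_end s) Q -> single s P = single s Q.
Proof. by move=> h; apply/ffunP => t; rewrite !ffunE h. Qed.

Lemma single_normal x s : normal x -> (forall t, t != s -> x t = 0) ->
  x = single s (x s).
Proof.
move=> nx x0; apply/ffunP => t; rewrite ffunE.
by case: eqVneq => [->|/x0 //]; rewrite nx.
Qed.

Lemma pdiff_singleU1 s v P : v \notin s ->
  pdiff le (single s P) (v |: s) = sub (arc_end (v |: s)) P *~ edge_sign le (v |: s) v.
Proof.
move=> vs; rewrite pdiffE (bigD1 v) ?setU11 //= [X in _ + X]big1 ?addr0.
  by rewrite (setU1K vs) ffunE eqxx (sub_arc_end _ (subsetUr _ _)).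
move=> e /andP[es ev]; rewrite ffunE ifN ?raddf0 ?mul0rz //.
by apply: contraNneq vs => <-; rewrite !inE eq_sym ev eqxx.
Qed.

Lemma pdiff_single_out s t P :
  (forall v, v \notin s -> t != v |: s) -> pdiff le (single s P) t = 0.
Proof.
move=> h; rewrite pdiffE; apply: big1 => e es; rewrite ffunE ifN ?raddf0 ?mul0rz //.
apply: contraTneq es => E; have es : e \notin s by rewrite -E !inE eqxx.
by have := h e es; apply: contraNN => et; rewrite -E setD1K.
Qed.

Lemma pdiff_single0 s P :
  (forall v, v \notin s -> sub (arc_end (v |: s)) P = 0) -> pdiff le (single s P) = 0.
Proof.
move=> h; apply/ffunP => t; rewrite [RHS]ffunE.
case: (boolP [exists v, (v \notin s) && (t == v |: s)]) =>
  [/existsP[v /andP[vs /eqP ->]]|].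
  by rewrite pdiff_singleU1 // h // mul0rz.
rewrite negb_exists => /forallP h'; apply: pdiff_single_out => v vs.
by have := h' v; rewrite vs.
Qed.

Lemma pdiff_single1 s v P : v \notin s ->
  (forall u, u \notin s -> u != v -> sub (arc_end (u |: s)) P = 0) ->
  pdiff le (single s P) = single (v |: s) (P *~ edge_sign le (v |: s) v).
Proof.
move=> vs h; apply/ffunP => t; rewrite [RHS]ffunE.
case: (eqVneq t (v |: s)) => [->|tv]; first by rewrite pdiff_singleU1 // raddfMz.
case: (boolP [exists u, (u \notin s) && (t == u |: s)]) =>
  [/existsP[u /andP[us /eqP E]]|].
  rewrite E pdiff_singleU1 // h ?mul0rz //.
  by apply: contraNneq tv => <-; rewrite E.
rewrite negb_exists => /forallP h'; apply: pdiff_single_out => u us.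
by have := h' u; rewrite us.
Qed.

(** The relation between [r] and [i] is additive to avoid truncated subtraction. The vertices
    [0, ..., r] are then the arc ends of [T i]. *)
Lemma in_tail i r v : (r + i = m.+1)%N -> (v \in T i) = (r < v)%N.
Proof. by move=> h; rewrite inE; lia. Qed.

(** The tail leads from [v] to the last vertex and then on to vertex 0, whose edge is missing. *)
Lemma tail_arc_end i v : (i < n)%N -> v \in T i -> arc_end (T i) v = ord0.
Proof.
move=> iN; have z : ord0 \notin T i by rewrite inE /=; lia.
have [k] := ubnP (n - v); elim: k v => // k IH v vk vT.
rewrite -(arc_end_ordS vT); have [vm|vm] := ltnP v.+1 n.
  have E : (ordS v = v.+1 :> nat)%N by rewrite /= modn_small.
  by apply: IH; [rewrite E; lia | move: vT; rewrite !inE E; lia].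
rewrite (_ : ordS v = ord0) ?arc_end_out //; apply: val_inj => /=.
by rewrite (_ : v.+1 = n) ?modnn //; have := ltn_ord v; lia.
Qed.

Definition lin_path r : {mpoly int[n]} := \prod_(v : 'I_n | (v < r)%N) lin (v, ordS v).

Lemma val_ordS v : (v < m.+1)%N -> ordS v = v.+1 :> nat.
Proof. by move=> h; rewrite /= modn_small. Qed.

(** Vertex [v] ends an arc of [T i], and adding its edge merges this arc with the next one. On a
    normal [P] this only replaces the variable of [v] by that of the end of the next arc. *)
Lemma fuse_out i v P : (i.+1 < n)%N -> v \notin T i ->
  sub (arc_end (T i)) P = P -> sub (arc_end (v |: T i)) P = 0 ->
  sub (fuse (v, arc_end (T i) (ordS v))) P = 0.
Proof.
move=> iN vT nP P0; rewrite -nP sub_comp; rewrite -nP sub_comp in P0.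
rewrite -[RHS]P0; apply: eq_sub => u /=; set a := arc_end (T i) u.
have TT : T i != setT by apply: contraNneq vT => ->; rewrite inE.
have aT : a \notin T i by apply: arc_end_notin.
rewrite /fuse /=; case: eqVneq => [->|av]; last first.
  by rewrite arc_end_out // !inE negb_or av; move: aT; rewrite inE.
rewrite -(arc_end_ordS (setU11 v (T i))) -(arc_end_sub _ (subsetUr [set v] (T i))).
rewrite [RHS]arc_end_out // in_setU1 negb_or arc_end_notin // andbT.
case: (boolP (ordS v \in T i)) => [h|h].
  rewrite tail_arc_end ?(ltnW iN) //; apply: contraTneq h => <-.
  by rewrite inE /= modn_small //; lia.
rewrite arc_end_out //; apply/eqP => /(congr1 val) /=.
move: vT; rewrite inE => vT; have := ltn_ord v.
case: (eqVneq v.+1 n) => [E|]; first by rewrite E modnn; lia.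
by move=> h1 h2; rewrite modn_small; lia.
Qed.

Lemma homog_sub_mul (d s : nat) (L Q : {mpoly int[n]}) :
  L \is s.-homog -> homog_sub d s Q -> L * Q \is d.-homog.
Proof.
rewrite /homog_sub => hL; case: leqP => [sd hQ|_ /eqP ->].
  by have := dhomogM hL hQ; rewrite subnKC.
by rewrite mulr0 rpred0.
Qed.

Definition path_pairs r : seq ('I_n * 'I_n) :=
  [seq (v, ordS v) | v <- enum 'I_n & (v < r)%N].

Lemma prod_path_pairs r : \prod_(p <- path_pairs r) lin p = lin_path r.
Proof. by rewrite big_map big_filter big_enum_cond. Qed.

Lemma size_path_pairs r : (r <= n)%N -> size (path_pairs r) = r.
Proof.
move=> rn; rewrite size_map size_filter.
rewrite -(count_map val (fun k => k < r)%N) val_enum_ord.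
rewrite -[n in iota 0 n](subnKC rn) iotaD count_cat add0n.
rewrite (eq_in_count (a2 := predT)) => [|k]; last by rewrite mem_iota add0n.
rewrite count_predT size_iota (eq_in_count (a2 := pred0)) ?count_pred0 ?addn0 // => k.
by rewrite mem_iota /= => /andP[h _]; rewrite ltnNge h.
Qed.

Lemma lin_path_homog r : (r <= n)%N -> lin_path r \is r.-homog.
Proof.
move=> rn; rewrite -prod_path_pairs -[X in X.-homog](size_path_pairs rn).
exact: prod_lin_homog.
Qed.

(** For [r <= m.+1] the pairs form a path that does not close up, so identifying the ends of one
    edge does not identify those of another. *)
Lemma pairwise_path_pairs r : (r <= m.+1)%N ->
  pairwise (fun p q => fuse p q.1 != fuse p q.2) (path_pairs r).
Proof.
move=> rn; rewrite pairwise_map.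
have U : uniq [seq v : 'I_n <- enum 'I_n | (v < r)%N] by rewrite filter_uniq // enum_uniq.
rewrite uniq_pairwise in U; apply: (sub_in_pairwise (P := fun v : 'I_n => (v < r)%N)) U.
  move=> v u vr ur vu; have uv : (u == v) = false by rewrite eq_sym; apply: negbTE.
  rewrite /fuse /= uv.
  have uS : ordS u = u.+1 :> nat by apply: val_ordS; apply: leq_trans ur rn.
  case: (eqVneq (ordS u) v) => [Suv|_].
    apply/eqP => /(congr1 (@nat_of_ord n)); rewrite val_ordS; last exact: leq_trans vr rn.
    by rewrite -Suv uS; lia.
  by apply/eqP => /(congr1 (@nat_of_ord n)); rewrite uS; lia.
exact: filter_all.
Qed.

Lemma tail_div r i j P : (r + i = m.+1)%N -> (0 < r)%N ->
  P \is j.-homog -> sub (arc_end (T i)) P = P ->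
  (forall v, (v < r)%N -> sub (arc_end (v |: T i)) P = 0) ->
  exists2 Q, P = lin_path r * Q & homog_sub j r Q.
Proof.
move=> ri r0 hP nP P0.
have rn : (r <= m.+1)%N by rewrite -ri leq_addr.
rewrite -prod_path_pairs -[X in homog_sub j X](@size_path_pairs r) ?(leqW rn) //.
apply: prod_lin_div => //; last exact: pairwise_path_pairs.
move=> _ /mapP[v + ->]; rewrite mem_filter => /andP[vr _].
have vT : v \notin T i by rewrite (in_tail _ ri) -leqNgt ltnW.
have := fuse_out _ vT nP (P0 v vr); rewrite arc_end_out; first by apply; lia.
by rewrite (in_tail _ ri) -leqNgt val_ordS //; apply: leq_trans vr rn.
Qed.

(** For [r = 1] the closing form x_r - x_0 would be the path form up to sign; for larger [r] it
    stays nonzero against each of the path forms, and the division goes through. *)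
Lemma tail_div_cycle (r : 'I_n) i j P : (r + i = m.+1)%N -> (1 < r)%N ->
  P \is j.-homog -> sub (arc_end (T i)) P = P ->
  (forall v, (v <= r)%N -> sub (arc_end (v |: T i)) P = 0) ->
  exists2 Q, P = lin (r, ord0) * lin_path r * Q & homog_sub j r.+1 Q.
Proof.
move=> ri r1 hP nP P0.
have rn : (r <= m.+1)%N by rewrite -ltnS ltn_ord.
have E : \prod_(p <- (r, ord0) :: path_pairs r) lin p = lin (r, ord0) * lin_path r.
  by rewrite big_cons prod_path_pairs.
have S : size ((r, ord0) :: path_pairs r) = r.+1 by rewrite /= size_path_pairs ?(leqW rn).
rewrite -E -S; apply: prod_lin_div => //.
  move=> p; rewrite inE => /orP[/eqP ->|/mapP[v + ->]].
    have rT : r \notin T i by rewrite (in_tail _ ri) ltnn.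
    have := fuse_out _ rT nP (P0 r (leqnn r)).
    suff -> : arc_end (T i) (ordS r) = ord0 by apply; lia.
    (* The vertex after [r] is 0 itself if the tail is empty; otherwise it lies on the arc that ends
       at 0. *)
    have [i0|i0] := posnP i.
      have -> : ordS r = ord0.
        by apply: val_inj; rewrite /= (_ : r.+1 = n) ?modnn //; lia.
      by rewrite arc_end_out // inE /=; lia.
    by rewrite tail_arc_end ?(in_tail _ ri) ?val_ordS //; lia.
  rewrite mem_filter => /andP[vr _].
  have vT : v \notin T i by rewrite (in_tail _ ri) -leqNgt ltnW.
  have := fuse_out _ vT nP (P0 v (ltnW vr)); rewrite arc_end_out; first by apply; lia.
  by rewrite (in_tail _ ri) -leqNgt val_ordS //; apply: leq_trans vr rn.
rewrite /= pairwise_path_pairs // andbT; apply/allP => _ /mapP[v + ->].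
rewrite mem_filter => /andP[vr _]; rewrite /fuse /=.
have vS : ordS v = v.+1 :> nat by apply: val_ordS; apply: leq_trans vr rn.
have -> : (v == r) = false by apply/eqP => vE; rewrite vE ltnn in vr.
case: (eqVneq (ordS v) r) => [vr'|_]; apply/eqP => /(congr1 (@nat_of_ord n));
  last by rewrite vS; lia.
by have := congr1 (@nat_of_ord n) vr'; rewrite vS /=; lia.
Qed.

End TailPolynomials.

(** * Passage to polynomial representatives, and the degrees where the cohomology vanishes *)

Section PolygonCohomology.
Variables (m : nat) (le : rel 'I_m.+2).
Hypotheses (le_anti : antisymmetric le) (le_total : total le).
Local Notation n := m.+2.
Local Notation ends := (@polygon n).
Local Notation C := (graph_complex ends {poly int}).
Local Notation T := (tail_set m).
Local Notation pdiff := (pdiff le).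
Implicit Types (s : {set 'I_n}) (u v e f g : 'I_n) (P Q F : {mpoly int[n]}).
Implicit Types (x y w : {ffun {set 'I_n} -> {mpoly int[n]}}) (i j r : nat).

Definition pcoboundary i j x : Prop :=
  if i is i'.+1 then exists2 y, pchain i' j y & x = pdiff y else x = 0.

Lemma pcoboundary_fam i j (z : C) :
  is_coboundary le deg_Zx i j z <-> pcoboundary i j (plift_fam z).
Proof.
case: i => [|i] /=.
  split=> [->|h]; first exact: raddf0.
  by apply: plift_fam_inj; rewrite h; apply/esym; exact: raddf0.
split=> [[y hy ->]|[y hy E]].
  by exists (plift_fam y); [apply/plift_fam_chain | rewrite plift_fam_diff].
have ny : normal y by case: hy.
exists (pclass_fam y); first by apply/plift_fam_chain; rewrite pclass_famK.
by apply: plift_fam_inj; rewrite plift_fam_diff pclass_famK.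
Qed.

Lemma pcoboundaryD i j x y :
  pcoboundary i j x -> pcoboundary i j y -> pcoboundary i j (x + y).
Proof.
case: i => [|i] /=; first by move=> -> ->; rewrite addr0.
move=> [a ha ->] [b hb ->]; exists (a + b); first exact: pchainD.
by rewrite raddfD.
Qed.

Lemma pcoboundaryB i j x y :
  pcoboundary i j x -> pcoboundary i j y -> pcoboundary i j (x - y).
Proof.
case: i => [|i] /=; first by move=> -> ->; rewrite subr0.
move=> [a ha ->] [b hb ->]; exists (a - b); first exact: pchainB.
by rewrite raddfB.
Qed.

Lemma pcoboundary0 i j : pcoboundary i j 0.
Proof. by case: i => //= i; exists 0; [exact: pchain0 | rewrite raddf0]. Qed.

Lemma free_of_rank_polygon i j r (b : 'I_r -> {ffun {set 'I_n} -> {mpoly int[n]}}) :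
  (forall k, pchain i j (b k) /\ pdiff (b k) = 0) ->
  (forall x, pchain i j x -> pdiff x = 0 -> exists! c : {ffun 'I_r -> int},
     pcoboundary i j (x - \sum_k b k *~ c k)) ->
  free_of_rank (H_polygon le i j) r.
Proof.
move=> hb hx; have nb (k : 'I_r) : normal (b k) by case: (hb k) => -[].
have diff0 (z : C) : graph_diff le z = 0 <-> pdiff (plift_fam z) = 0.
  rewrite -plift_fam_diff; split=> [->|h]; first exact: raddf0.
  by apply: plift_fam_inj; rewrite h; apply/esym; exact: raddf0.
apply: (@free_of_rank_cohomology _ _ _ _ _ _ _ _ _ (fun k => pclass_fam (b k))).
  move=> k; apply/asboolP; split.
    by apply/plift_fam_chain; rewrite pclass_famK //; case: (hb k).
  by apply/diff0; rewrite pclass_famK //; case: (hb k).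
move=> z /asboolP[/plift_fam_chain hz /diff0 dz].
have [c [hc uc]] := hx _ hz dz.
have E (c' : {ffun 'I_r -> int}) :
    plift_fam (z - \sum_k pclass_fam (b k) *~ c' k) =
    plift_fam z - \sum_k b k *~ c' k.
  rewrite raddfB raddf_sum /=; congr (_ - _); apply: eq_bigr => k _.
  by rewrite raddfMz /= pclass_famK.
exists c; split=> [|c']; first by apply/pcoboundary_fam; rewrite E.
by move=> /pcoboundary_fam; rewrite E; apply: uc.
Qed.

Lemma free_of_rank0_polygon i j :
  (forall x, pchain i j x -> pdiff x = 0 -> pcoboundary i j x) ->
  free_of_rank (H_polygon le i j) 0.
Proof.
move=> h; apply: (@free_of_rank_polygon i j 0 (fun _ => 0)) => [[]//|x hx dx].
exists [ffun _ => 0]; split; first by rewrite big_ord0 subr0; apply: h.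
by move=> c _; apply/ffunP => -[].
Qed.

Lemma tail_cocycle i j x : (i <= n)%N -> pchain i j x -> supp_above i x ->
  exists P, [/\ P \is j.-homog, sub (arc_end (T i)) P = P & x = single (T i) P].
Proof.
move=> iN hx Lx; exists (x (T i)); have [nx hx'] := hx; split.
- by have := hx' (T i); rewrite card_tail_set // eqxx.
- exact: nx.
- by apply: single_normal => // t; apply: (supp_above_single iN hx Lx).
Qed.

Lemma single_cocycle s P v : v \notin s -> pdiff (single s P) (v |: s) = 0 ->
  sub (arc_end (v |: s)) P = 0.
Proof.
move=> vs; rewrite pdiff_singleU1 // => h.
by have := congr1 (fun Q => Q *~ edge_sign le (v |: s) v) h; rewrite edge_signK mul0rz.
Qed.

(** The reduction leaves only sets of [i.+1] edges that contain the tail of this size, hence the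
    tail itself; the cocycle condition then says that each further edge kills [P]. *)
Lemma cohomologous_tail i j x : (i < n)%N -> pchain i.+1 j x -> pdiff x = 0 ->
  exists P, [/\ P \is j.-homog, sub (arc_end (T i.+1)) P = P,
    forall v, v \notin T i.+1 -> sub (arc_end (v |: T i.+1)) P = 0 &
    pcoboundary i.+1 j (x - single (T i.+1) P)].
Proof.
move=> iN hx dx.
have [|w hw Lw] := reduce_chain le_anti le_total iN (leqnn i.+1) hx.
  by move=> s _; rewrite dx ffunE.
have hxw : pchain i.+1 j (x - pdiff w) by apply: pchainB => //; apply: pchain_diff.
have [P [hP nP E]] := tail_cocycle iN hxw Lw.
exists P; split=> // [v vT|]; last by rewrite -E opprB addrCA subrr addr0; exists w.
apply: single_cocycle vT _.
by rewrite -E raddfB /= dx (pdiffK le_anti le_total hw) subrr ffunE.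
Qed.

(** Without edge 0 the polygon is still connected, so the class at the full edge set comes from the
    same polynomial, up to sign, at [T m.+1]. *)
Lemma H_polygon_top j : free_of_rank (H_polygon le n j) 0.
Proof.
apply: free_of_rank0_polygon => x hx dx.
have [P [hP nP _ cP]] := cohomologous_tail (ltnSn _) hx dx.
rewrite -[x](subrK (single (T n) P)); apply: pcoboundaryD => //.
have z0 : ord0 \notin T m.+1 by rewrite (in_tail _ (add0n _)).
exists (single (T m.+1) (P *~ edge_sign le (ord0 |: T m.+1) ord0)).
  rewrite -[X in pchain X](@card_tail_set m m.+1) //; apply: single_chain.
  by rewrite -scaler_int rpredZ.
rewrite (pdiff_single1 _ z0) => [|u]; last first.
  rewrite (in_tail _ (add0n _)) -leqNgt leqn0 => u0 /negP[].
  by rewrite -val_eqE.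
by rewrite edge_signK (@tail_setS m m.+1 ord0) //= subnn.
Qed.

(** Adding the last missing edge merges no components and acts as the identity, so the cocycle
    condition forces [P = 0]. *)
Lemma H_polygon_subtop j : free_of_rank (H_polygon le m.+1 j) 0.
Proof.
apply: free_of_rank0_polygon => x hx dx.
have [P [hP nP P0 cP]] := cohomologous_tail (ltnW (ltnSn _)) hx dx.
rewrite -[x](subrK (single (T m.+1) P)); apply: pcoboundaryD => //.
have z0 : ord0 \notin T m.+1 by rewrite (in_tail _ (add0n _)).
have {}P0 := P0 ord0 z0.
suff -> : P = 0 by rewrite raddf0; apply: pcoboundary0.
rewrite -nP -P0; apply: eq_sub => u; rewrite {2}/arc_end ifT.
  have [->|u0] := eqVneq u ord0; first exact: arc_end_out.
  by apply: tail_arc_end => //; rewrite (in_tail _ (add0n _)) lt0n.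
apply/eqP/setP => v; rewrite !inE; case: eqVneq => //= v0.
have : (0 < v)%N by rewrite lt0n.
by rewrite subSn // subnn.
Qed.

Lemma H_polygon_above i j : (n < i)%N -> free_of_rank (H_polygon le i j) 0.
Proof.
move=> iN; apply: free_of_rank0_polygon => x [_ hx] _.
suff -> : x = 0 by apply: pcoboundary0.
apply/ffunP => s; rewrite ffunE; have := hx s; case: eqP => // cs _.
by have := max_card (mem s); rewrite cs card_ord leqNgt iN.
Qed.

Lemma lin_path_vanish (s : {set 'I_n}) r v Q : (v < r)%N -> v \in s ->
  sub (arc_end s) (lin_path m r * Q) = 0.
Proof.
move=> vr vs; rewrite /lin_path (bigD1 v) //= -mulrA rmorphM /= raddfB /= !subX.
by rewrite arc_end_ordS // subrr mul0r.
Qed.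

Lemma lin_pathS r : (r < n)%N ->
  lin_path m r.+1 = lin (inord r, ordS (inord r)) * lin_path m r.
Proof.
move=> rn; have rE : (inord r : 'I_n) = r :> nat by rewrite inordK.
rewrite /lin_path (bigD1 (inord r)) /= ?rE //; congr (_ * _); apply: eq_bigl => v.
by rewrite ltnS -val_eqE /= rE ltn_neqAle andbC.
Qed.

(* The linear form of the path that closes up in [T i.+1] becomes the last
   factor of the cycle once the edge [r + 1] is added to [T i]. *)
Lemma H_polygon_middle i j : (0 < i)%N -> (i < m)%N ->
  free_of_rank (H_polygon le i j) 0.
Proof.
case: i => // i _ im; apply: free_of_rank0_polygon => x hx dx.
have iN : (i < n)%N by lia.
have [P [hP nP P0 cP]] := cohomologous_tail iN hx dx.
rewrite -[x](subrK (single (T i.+1) P)); apply: pcoboundaryD => //.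
have rN : (m - i < n)%N by lia.
pose r : 'I_n := Ordinal rN; have ri : (r + i.+1 = m.+1)%N by rewrite /=; lia.
have r'N : (r.+1 < n)%N by rewrite /=; lia.
pose r' : 'I_n := Ordinal r'N; have ri' : (r' + i = m.+1)%N by rewrite /=; lia.
have r1 : (1 < r)%N by rewrite /=; lia.
have [|Q EQ hQ] := tail_div_cycle ri r1 hP nP.
  by move=> v vr; apply: P0; rewrite (in_tail _ ri) -leqNgt.
pose F := lin_path m r.+1 * Q.
have hF : F \is j.-homog.
  by apply: homog_sub_mul hQ; apply: lin_path_homog; apply: ltnW.
have rT : r' \notin T i by rewrite (in_tail _ ri') ltnn.
have TE : T i.+1 = r' |: T i by apply: tail_setS => //=; lia.
exists (single (T i) (F *~ edge_sign le (r' |: T i) r')).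
  rewrite -[X in pchain X](@card_tail_set m i) ?(ltnW iN) //; apply: single_chain.
  by rewrite -scaler_int rpredZ.
(* Any other edge [u] outside [T i] precedes [r'] and kills [F] through the factor x_u - x_(u+1). *)
rewrite (pdiff_single1 _ rT) => [|u]; last first.
  rewrite (in_tail _ ri') -leqNgt => ur' une; rewrite raddfMz /=.
  rewrite (@lin_path_vanish _ _ u) ?mul0rz ?setU11 //.
  by move: une; rewrite -val_eqE /= => une; rewrite ltn_neqAle une.
rewrite edge_signK -TE; apply: eq_single.
have subM P1 P2 P3 : sub (arc_end (T i.+1)) (P1 * P2 * P3) =
    sub (arc_end (T i.+1)) P1 * sub (arc_end (T i.+1)) P2 * sub (arc_end (T i.+1)) P3.
  by rewrite !rmorphM.
have Sr : ordS r = r' by apply: val_inj; rewrite /= modn_small.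
(* Vertex [r'] lies on the arc of [T i.+1] that ends at 0. *)
have E : sub (arc_end (T i.+1)) (lin (r, r')) = sub (arc_end (T i.+1)) (lin (r, ord0)).
  rewrite !raddfB /= !subX; congr (_ - 'X_ _).
  rewrite (@tail_arc_end _ i.+1 r') ?(in_tail _ ri) //; try lia.
  by rewrite arc_end_out // inE /=; lia.
by rewrite /F (lin_pathS (ltn_ord r)) inord_val Sr EQ [LHS]subM [RHS]subM E.
Qed.
End PolygonCohomology.

(** * Degree 0 *)

Section ExtremalDegrees.
Variables (m : nat) (le : rel 'I_m.+2).
Hypotheses (le_anti : antisymmetric le) (le_total : total le).
Local Notation n := m.+2.
Local Notation T := (tail_set m).
Local Notation pdiff := (pdiff le).
Local Notation lin_path := (lin_path m).
Implicit Types (s : {set 'I_n}) (u v e f g : 'I_n) (P Q F : {mpoly int[n]}).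
Implicit Types (x y w : {ffun {set 'I_n} -> {mpoly int[n]}}) (i j : nat).

Lemma ordS_neq v : ordS v != v.
Proof.
apply/eqP => /(congr1 (@nat_of_ord n)) /=; have := ltn_ord v.
case: (eqVneq v.+1 n) => [E|]; first by rewrite E modnn; lia.
by move=> h1 h2; rewrite modn_small; lia.
Qed.

Lemma lin_ordS_neq0 v : lin (v, ordS v) != 0 :> {mpoly int[n]}.
Proof.
rewrite /lin /= subr_eq0; apply/eqP => E.
have /= := congr1 (fun P => P@_(U_(v)%MM)) E; rewrite !mcoeffXU eqxx.
by rewrite (negbTE (ordS_neq v)).
Qed.

Lemma lin_path_neq0 r : lin_path r != 0.
Proof. by apply/prodf_neq0 => v _; apply: lin_ordS_neq0. Qed.

Lemma lin_path1 : lin_path 1 = lin (ord0, ordS ord0).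
Proof.
rewrite (@lin_pathS _ 0) // [X in _ * X]big_pred0_eq mulr1.
by rewrite (_ : inord 0 = ord0) //; apply: val_inj; rewrite /= inordK.
Qed.

Lemma homog_mulrz d P (c : int) : P \is d.-homog -> P *~ c \is d.-homog.
Proof. by move=> hP; rewrite -scaler_int rpredZ. Qed.

(** On the diagonal, a homogeneous polynomial reduces to one integer, the sum of its coefficients.
    This integer is the invariant used in the exceptional degree. *)
Lemma sub_const u d Q : Q \is d.-homog ->
  exists c : int, sub (fun=> u) Q = 'X_u ^+ d *~ c.
Proof.
move=> /dhomogP hQ; rewrite [Q]mpolyE raddf_sum big_seq /=.
elim/big_ind: _ => [|P1 P2 [c1 ->] [c2 ->]|k hk].
- by exists 0; rewrite mulr0z.
- by exists (c1 + c2); rewrite mulrzDr.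
exists Q@_k; rewrite -[Q@_k in LHS]intz scaler_int raddfMz /= subXm -(hQ k hk) /=.
by rewrite mdegE -prodrXr.
Qed.

Lemma expX_mulrz_eq0 u d (c : int) : ('X_u : {mpoly int[n]}) ^+ d *~ c = 0 -> c = 0.
Proof.
move=> /(congr1 (fun P => P@_(U_(u) *+ d)%MM)); rewrite raddfMz /= mcoeffXn eqxx.
by rewrite raddf0 intz.
Qed.

(* The two edges of the 2-gon give the same linear form up to sign. *)
Let D := if n == 2%N then 1%N else n.

(** Each edge has its own factor, the closing edge included because [ordS] wraps around. The
    exception is edge 1 of the 2-gon, which shares the factor of edge 0. *)
Lemma cycle_vanish v Q : sub (arc_end (v |: T 0)) (lin_path D * Q) = 0.
Proof.
have [vD|Dv] := ltnP v D; first by rewrite (@lin_path_vanish _ _ _ v) ?setU11.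
have m0 : m = 0%N.
  by move: Dv; rewrite /D; case: eqP => [[]//|_]; rewrite leqNgt ltn_ord.
have D1 : D = 1%N by rewrite /D m0.
have vE : v = 1%N :> nat by have := ltn_ord v; move: Dv; rewrite D1; lia.
have Sv : ordS v = ord0 by apply: val_inj; rewrite /= vE m0.
have S0 : ordS ord0 = v by apply: val_inj; rewrite /= vE m0.
rewrite D1 lin_path1 S0 rmorphM /= raddfB /= !subX.
by rewrite -(arc_end_ordS (setU11 v _)) Sv subrr mul0r.
Qed.

Lemma cycle_div j P : P \is j.-homog ->
  (forall v, sub (arc_end (v |: T 0)) P = 0) ->
  exists2 Q, P = lin_path D * Q & homog_sub j D Q.
Proof.
move=> hP P0; have nP : sub (arc_end (T 0)) P = P.
  apply: sub_id => u; apply: arc_end_out.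
  by rewrite inE subn0 -ltnNge.
have [m0|m0] := posnP m.
  have D1 : D = 1%N by rewrite /D m0.
  rewrite D1; apply: (@tail_div _ 1 0 j P) => //; first by rewrite m0.
have DE : D = n by rewrite /D; case: eqP => // -[E]; rewrite E in m0.
have [|//|//|Q EQ hQ] := @tail_div_cycle m ord_max 0 j P _ _ hP nP.
  by rewrite addn0.
exists Q; rewrite DE // EQ (@lin_pathS m m.+1) //.
have -> : inord m.+1 = ord_max :> 'I_n by apply: val_inj; rewrite /= inordK.
by rewrite (_ : ordS ord_max = ord0) //; apply: val_inj; rewrite /= modnn.
Qed.

Lemma D_le : (D <= n)%N.
Proof. by rewrite /D; case: ifP. Qed.

Lemma zero_supp j x : pchain 0 j x -> supp_above 0 x.
Proof.
move=> _ s /negP[]; apply/subsetP => v.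
by rewrite inE subn0 leqNgt ltn_ord.
Qed.

Lemma single0_inj P : single (T 0) P = 0 -> P = 0.
Proof.
move=> /ffunP/(_ (T 0)); rewrite !ffunE eqxx => <-.
apply/esym/sub_id => u; apply: arc_end_out.
by rewrite inE subn0 -ltnNge.
Qed.

(** There are no coboundaries in degree 0, and cocycles are the multiples of [lin_path D].
    Multiplication by this nonzero polynomial is injective and carries the monomials of degree
    [j - D] to a basis. *)
Lemma H_polygon_0 j :
  free_of_rank (H_polygon le 0 j)
    (if (D <= j)%N then #|monos n (j - D)| else 0%N).
Proof.
have T0 : #|T 0| = 0%N by rewrite card_tail_set.
have cyc x : pchain 0 j x -> pdiff x = 0 ->
    exists2 Q, x = single (T 0) (lin_path D * Q) & homog_sub j D Q.
  move=> hx dx; have [P [hP nP E]] := tail_cocycle (leq0n _) hx (zero_supp hx).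
  have [|Q EQ hQ] := cycle_div hP; last by exists Q; rewrite // -EQ.
  move=> v; apply: (@single_cocycle _ le).
    by rewrite inE subn0 -ltnNge.
  by rewrite -E dx ffunE.
case: ifP => Dj; last first.
  apply: free_of_rank0_polygon => // x hx dx; have [Q ->] := cyc x hx dx.
  by rewrite /homog_sub Dj => /eqP ->; rewrite mulr0 raddf0.
pose X (k : 'I_#|monos n (j - D)|) := 'X_[monom (enum_val k)] : {mpoly int[n]}.
have hX k : X k \is (j - D).-homog.
  by rewrite dhomogX /= mdeg_monom ?enum_valP.
apply: (@free_of_rank_polygon m le 0 j _
          (fun k => single (T 0) (lin_path D * X k))).
  move=> k; split; last by apply: pdiff_single0 => v _; apply: cycle_vanish.
  rewrite -{1}T0; apply: single_chain; apply: (@homog_sub_mul _ j D).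
    by apply: lin_path_homog; apply: D_le.
  by rewrite /homog_sub Dj.
move=> x hx dx; have [Q -> hQ] := cyc x hx dx.
move: hQ; rewrite /homog_sub Dj => /homog_basis[c [Ec uc]].
have sE (c' : {ffun 'I_#|monos n (j - D)| -> int}) :
    \sum_k single (T 0) (lin_path D * X k) *~ c' k =
    single (T 0) (lin_path D * \sum_k c' k *: X k).
  rewrite mulr_sumr raddf_sum; apply: eq_bigr => k _ /=.
  by rewrite -[c' k in RHS]intz scaler_int mulrzAr raddfMz.
exists c; split=> [|c']; first by rewrite sE -Ec subrr.
rewrite /= sE -raddfB /= => /single0_inj; rewrite -mulrBr => /eqP.
by rewrite mulf_eq0 (negbTE (lin_path_neq0 _)) /= subr_eq0 => /eqP /uc.
Qed.
End ExtremalDegrees.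

(** * The exceptional degree n - 2, for n > 2 *)

Section ExceptionalDegree.
Variables (m : nat) (le : rel 'I_m.+2).
Hypotheses (le_anti : antisymmetric le) (le_total : total le).
Hypothesis m_gt0 : (0 < m)%N.
Local Notation n := m.+2.
Local Notation T := (tail_set m).
Local Notation pdiff := (pdiff le).
Local Notation lin_path := (lin_path m).
Local Notation v1 := (ordS ord0 : 'I_n).
Implicit Types (s : {set 'I_n}) (u v e f g : 'I_n) (P Q F : {mpoly int[n]}).
Implicit Types (x y w : {ffun {set 'I_n} -> {mpoly int[n]}}) (i j : nat).

Let v2 : 'I_n := ordS v1.

Lemma pcoboundary_gt0 i j x : (0 < i)%N ->
  pcoboundary le i j x <-> exists2 y, pchain i.-1 j y & x = pdiff y.
Proof. by case: i. Qed.

Lemma val_v2 : v2 = 2%N :> nat.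
Proof. by rewrite /v2 /= !modn_small. Qed.

Lemma tail_v2 : T m = v2 |: T m.-1.
Proof.
have -> : T m = T m.-1.+1 by rewrite prednK.
by apply: tail_setS; rewrite ?val_v2; lia.
Qed.

Lemma v2_notin : v2 \notin T m.-1.
Proof. by rewrite (@in_tail _ _ 2) ?val_v2 //; lia. Qed.

Lemma lt2_notin v : (v < 2)%N -> v \notin T m.-1.
Proof. by rewrite inE; lia. Qed.

Lemma lt1_notin v : (v < 1)%N -> v \notin T m.
Proof. by rewrite inE; lia. Qed.

Lemma lin_path2 : lin_path 2 = lin (v1, v2) * lin_path 1.
Proof.
rewrite (@lin_pathS m 1) //.
have -> // : inord 1 = v1.
by apply: val_inj; rewrite /= inordK.
Qed.

Lemma arc_end_v2 s : T m \subset s -> arc_end s v2 = arc_end s ord0.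
Proof.
move=> /arc_end_sub E; rewrite -E -[RHS]E; congr (arc_end s _).
rewrite tail_arc_end ?arc_end_out ?inE ?val_v2 //=; lia.
Qed.

Lemma tail_lt2 v : v \notin T m -> v = ord0 \/ v = v1.
Proof.
rewrite inE => vm; have v2' : (v < 2)%N by lia.
have [v0|v0] := posnP v; [left|right]; apply: val_inj => //=.
by rewrite modn_small; lia.
Qed.

Lemma sub_tail_lin_path1 : sub (arc_end (T m)) (lin_path 1) = lin_path 1.
Proof.
rewrite lin_path1 raddfB /= !subX !arc_end_out //; rewrite inE /= ?modn_small; lia.
Qed.

(** Vertex 2 lies on the arc that ends at 0, so x_1 - x_2 becomes x_1 - x_0. This is how squares of
    [lin_path 1] arise in coboundaries. *)
Lemma sub_tail_lin : sub (arc_end (T m)) (lin (v1, v2)) = - lin_path 1.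
Proof.
rewrite lin_path1 raddfB /= !subX arc_end_v2 // !arc_end_out ?opprB //.
  by rewrite inE /=; lia.
by rewrite inE /= modn_small; lia.
Qed.

(** Both edges outside [T m] join the same two arcs, those ending at 0 and at 1. *)
Lemma lin_path1_vanish v Q : v \notin T m ->
  sub (arc_end (v |: T m)) (lin_path 1 * Q) = 0.
Proof.
case/tail_lt2 => ->; first by rewrite (@lin_path_vanish _ _ _ ord0) ?setU11.
rewrite lin_path1 rmorphM raddfB /= !subX.
by rewrite -(arc_end_ordS (setU11 v1 _)) -/v2 arc_end_v2 ?subsetUr // subrr mul0r.
Qed.

Lemma lin_path_cocycle j Q : homog_sub j 1 Q ->
  pchain m j (single (T m) (lin_path 1 * Q)) /\
  pdiff (single (T m) (lin_path 1 * Q)) = 0.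
Proof.
move=> hQ; split; last by apply: pdiff_single0 => v; apply: lin_path1_vanish.
rewrite -[X in pchain X](@card_tail_set m m) ?leqW //; apply: single_chain.
by apply: homog_sub_mul hQ; apply: lin_path_homog.
Qed.

(* A multiple [l * Q] of the linear form [l] represents a coboundary as soon as
   [Q] vanishes on the diagonal, because it is then a multiple of [l ^ 2]. *)
Lemma lin_path_coboundary j Q : (0 < j)%N -> Q \is j.-1.-homog ->
  sub (fun=> v1) Q = 0 -> pcoboundary le m j (single (T m) (lin_path 1 * Q)).
Proof.
move=> j0 hQ Q0; set Q1 := sub (arc_end (T m)) Q.
(* Only x_0 and x_1 occur in [Q1], so identifying them is the restriction to the diagonal. *)
have Q1v : sub (fuse (ord0, v1)) Q1 = 0.
  rewrite sub_comp -Q0; apply: eq_sub => u /=; rewrite /fuse /=.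
  have /tail_lt2[->|->] : arc_end (T m) u \notin T m.
    apply: arc_end_notin; apply/eqP => /setP/(_ ord0).
    by rewrite !inE /=; lia.
  - by rewrite eqxx.
  - by rewrite ?if_same.
have hQ1 : Q1 \is j.-1.-homog by apply: sub_homog.
have [Q2] := sub_fuse_div (ord0, v1) hQ1; rewrite Q1v subr0 -lin_path1 => E2 hQ2.
pose F := lin_path 2 * Q2.
have hF : F \is j.-homog.
  apply: (@homog_sub_mul _ j 2); first exact: lin_path_homog.
  move: hQ2; rewrite /homog_sub; have -> : (1 <= j.-1)%N = (2 <= j)%N by lia.
  by rewrite (_ : j.-1 - 1 = j - 2)%N //; lia.
apply/pcoboundary_gt0 => //.
(* In [F], the factor x_1 - x_2 becomes [- lin_path 1] in [T m]; the minus sign compensates for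
   this. *)
exists (single (T m.-1) (- F *~ edge_sign le (v2 |: T m.-1) v2)).
  rewrite -[X in pchain X](@card_tail_set m m.-1); last by lia.
  by apply: single_chain; rewrite homog_mulrz // rpredN.
rewrite (pdiff_single1 _ v2_notin) => [|u]; last first.
  rewrite (@in_tail _ _ 2); last by lia.
  rewrite -leqNgt => u2 uv2; rewrite raddfMz raddfN /= /F.
  rewrite (@lin_path_vanish _ _ _ u) ?setU11 ?oppr0 ?mul0rz //.
  by move: uv2; rewrite -(inj_eq (@ord_inj n)) val_v2; lia.
rewrite edge_signK -tail_v2; apply: eq_single.
rewrite /F lin_path2 raddfN /= !rmorphM /= sub_tail_lin sub_tail_lin_path1 -/Q1.
have E3 : Q1 = lin_path 1 * sub (arc_end (T m)) Q2.
  by rewrite -sub_tail_lin_path1 -rmorphM /= -E2 sub_arc_end.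
by rewrite E3; ring.
Qed.

Lemma pchain_reduce i j y : (i <= n)%N -> pchain i j y ->
  (forall s, ~~ (T i \subset s) -> pdiff y s = 0) ->
  exists y', [/\ pchain i j y', supp_above i y' & pdiff y' = pdiff y].
Proof.
case: i => [|i] iN hy dy; first by exists y; split=> //; apply: zero_supp hy.
have [w hw Lw] := reduce_chain le_anti le_total iN (leqnn i.+1) hy dy.
exists (y - pdiff w); split; first exact: pchainB hy (pchain_diff le hw).
  exact: Lw.
by rewrite raddfB /= (pdiffK le_anti le_total hw) subr0.
Qed.

(** A preimage can be moved to [T m.-1] without changing its differential. There it is a multiple of
    [lin_path 2], so its image is a multiple of the square of [lin_path 1]. *)
Lemma lin_path_not_coboundary j c :
  pcoboundary le m j (single (T m) (lin_path 1 * ('X_ord0 ^+ j.-1 *~ c))) -> c = 0.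
Proof.
move=> /(pcoboundary_gt0 _ _ m_gt0)[y hy E].
have [||y' [hy' Ly' Ey']] := @pchain_reduce m.-1 j y _ hy.
- by lia.
- move=> s hs; rewrite -E ffunE ifN //; apply: contraNneq hs => ->.
  by rewrite tail_v2 subsetUr.
have mN : (m.-1 <= n)%N by lia.
have [F [hF nF EF]] := tail_cocycle mN hy' Ly'.
have dF : pdiff (single (T m.-1) F) =
    single (T m) (lin_path 1 * ('X_ord0 ^+ j.-1 *~ c)) by rewrite -EF Ey' -E.
have [|//|v vlt|G EG _] := @tail_div m 2 m.-1 j F _ _ hF nF; first by lia.
  have vT : v \notin T m.-1 by apply: lt2_notin.
  apply: (single_cocycle (le := le) vT).
  (* The differential lives at [T m], that is, at [v2 |: T m.-1], so it vanishes at [v |: T m.-1]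
     for the edges [v] before [v2]. *)
  suff neq : v |: T m.-1 != T m by rewrite dF ffunE (negbTE neq).
  rewrite tail_v2; apply/eqP => /setP/(_ v); rewrite !inE eqxx /= => /esym/orP[/eqP vE|].
    by move: vlt; rewrite vE val_v2.
  by move: vT; rewrite inE => /negP.
have := congr1 (fun x => x (T m)) dF; rewrite {1}tail_v2 /=.
rewrite (pdiff_singleU1 _ _ v2_notin) -tail_v2 ffunE eqxx EG lin_path2.
rewrite !rmorphM /= sub_tail_lin sub_tail_lin_path1 => EE.
move: (sub _ G) EE => G' EE.
have {}EE : lin_path 1 * (- lin_path 1 * G' *~ edge_sign le (T m) v2) =
    lin_path 1 * sub (arc_end (T m)) ('X_ord0 ^+ j.-1 *~ c).
  by rewrite -EE mulrzAr; congr (_ *~ _); ring.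
(* After one factor [lin_path 1] is cancelled, the left side still contains another and vanishes on
   the diagonal, where the right side is [c] times a power of x_0. *)
move: EE => /(mulfI (lin_path_neq0 _ _)) /(congr1 (sub (fun=> ord0))).
rewrite !raddfMz /= !rmorphXn /= !subX rmorphM raddfN lin_path1 raddfB /= !subX subrr.
rewrite oppr0 mul0r mul0rz => /esym; exact: expX_mulrz_eq0.
Qed.

(** Each class is that of [lin_path 1 * Q] with [Q] of degree [j - 1], hence 0 for [j = 0]. For
    [j > 0] the value of [Q] on the diagonal determines it, and a power of x_0 gives the
    generator. *)
Lemma H_polygon_exceptional j : free_of_rank (H_polygon le m j) (0 < j)%N.
Proof.
have mN : (m <= n)%N by rewrite ltnW.
have cyc x : pchain m j x -> pdiff x = 0 -> exists2 Q,
    pcoboundary le m j (x - single (T m) (lin_path 1 * Q)) & homog_sub j 1 Q.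
  move=> hx dx; have [P [hP nP P0 cP]] : exists P, [/\ P \is j.-homog,
      sub (arc_end (T m)) P = P,
      forall v, v \notin T m -> sub (arc_end (v |: T m)) P = 0 &
      pcoboundary le m j (x - single (T m) P)].
    have h := @cohomologous_tail m le le_anti le_total m.-1 j x.
    by rewrite prednK in h => //; apply: h => //; lia.
  have [|//|v v0|Q EQ hQ] := @tail_div m 1 m j P _ _ hP nP; first by lia.
    exact: P0 (lt1_notin v0).
  by exists Q; [rewrite -EQ; exact: cP | exact: hQ].
have [j0|j0] := posnP j.
  apply: free_of_rank0_polygon => x hx dx; have [Q cQ] := cyc x hx dx.
  rewrite /homog_sub j0 /= => /eqP Q0.
  by move: cQ; rewrite Q0 mulr0 raddf0 subr0 j0.
pose b (_ : 'I_1) := single (T m) (lin_path 1 * 'X_ord0 ^+ j.-1).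
have bE (c : {ffun 'I_1 -> int}) : \sum_k b k *~ c k =
    single (T m) (lin_path 1 * ('X_ord0 ^+ j.-1 *~ c ord0)).
  by rewrite big_ord1 /b mulrzAr raddfMz.
apply: (@free_of_rank_polygon m le m j 1 b) => [k|x hx dx].
  apply: lin_path_cocycle; rewrite /homog_sub j0 subn1.
  by rewrite mpolyXn dhomogX /= mdegMn mdeg1 mul1n.
have [Q cQ] := cyc x hx dx; rewrite /homog_sub j0 subn1 => hQ.
have [c Ec] := sub_const v1 hQ.
have hX : ('X_ord0 ^+ j.-1 *~ c : {mpoly int[n]}) \is j.-1.-homog.
  by apply: homog_mulrz; rewrite mpolyXn dhomogX /= mdegMn mdeg1 mul1n.
(* [Q] and the multiple of the power of x_0 agree on the diagonal, so [lin_path_coboundary] applies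
   to their difference. *)
have cb : pcoboundary le m j (x - single (T m) (lin_path 1 * ('X_ord0 ^+ j.-1 *~ c))).
  rewrite -[x](subrK (single (T m) (lin_path 1 * Q))) -addrA.
  apply: pcoboundaryD; first exact: cQ.
  rewrite -raddfB /= -mulrBr.
  apply: lin_path_coboundary => //; first exact: rpredB.
  by rewrite raddfB /= Ec raddfMz /= rmorphXn /= subX subrr.
exists [ffun _ => c]; split; first by rewrite bE ffunE.
move=> c'; rewrite bE => cb'; apply/ffunP => k; rewrite ffunE (ord1 k).
apply/eqP; rewrite -subr_eq0; apply/eqP.
apply: (@lin_path_not_coboundary j).
rewrite mulrzBr mulrBr raddfB /=.
set a := single _ _ in cb *; set a' := single _ _ in cb' *.
have -> : a - a' = (x - a') - (x - a) by rewrite opprB [RHS]addrC addrA subrK.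
exact: pcoboundaryB.
Qed.
End ExceptionalDegree.

(** * All degrees together, and the Poincaré series *)

Lemma H_polygon_rank (m : nat) (le : rel 'I_m.+2) (i j : nat) :
  antisymmetric le -> total le ->
  free_of_rank (H_polygon le i j) (H_rank m.+2 i j).
Proof.
move=> le_anti le_total; rewrite /H_rank.
case: (eqVneq i 0%N) => [->|i0]; first exact: H_polygon_0.
rewrite !subSS subn0; case: (ltngtP i m) => [im|mi|im].
- by apply: H_polygon_middle => //; rewrite lt0n.
- move: mi; rewrite leq_eqVlt => /orP[/eqP <-|]; first exact: H_polygon_subtop.
  rewrite leq_eqVlt => /orP[/eqP <-|]; first exact: H_polygon_top.
  exact: H_polygon_above.
- by rewrite im in i0 *; apply: H_polygon_exceptional; rewrite // lt0n.
Qed.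

(* Power series in q over Z[[t]]: q is fpsX over fps int, and t is the constant
   fpsC (fpsX int). *)
Theorem corollary4p1 (n : nat) (hn : (2 <= n)%N)
    (le : rel 'I_n) (le_anti : antisymmetric le)
    (le_trans : transitive le) (le_total : total le) :
  let q : fps (fps int) := fpsX (fps int) in
  let t : fps (fps int) := fpsC (fpsX int) in
  let qs : fps (fps int) := fps_pos (fps int) in
  let P : fps (fps int) :=
    Fps (fun j => Fps (fun i => (free_rank (H_polygon le i j))%:Z)) in
  (forall i j : nat, free_finite_rank (H_polygon le i j)) /\
  P = qs ^+ n + t ^+ (n - 2) * qs /\
  qs ^+ n + t ^+ (n - 2) * qs =
    (q / (1 - q)) ^+ n + t ^+ (n - 2) * (q / (1 - q)).
Proof.
case: n hn le le_anti le_trans le_total => [|[|m]] // hn le le_anti _ le_total q t qs P.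
have rk i j : free_of_rank (H_polygon le i j) (H_rank m.+2 i j).
  exact: H_polygon_rank.
split; first by move=> i j; exists (H_rank m.+2 i j).
split; last by rewrite /qs fps_pos_div.
apply/fpsP => j; apply/fpsP => i.
by rewrite H_rank_series //= (free_rankE (rk i j)).
Qed.
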